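(* Let $f:\mathbb{R}^n\to\mathbb{R}$ be $\mathcal{C}^3$ on $B(x^0;\overline{\Delta})$, where $x^0\in\operatorname{dom} f=\mathbb{R}^n$ is the point of interest and $\overline{\Delta}>0$. Let $S=[s^1\;\cdots\;s^m]\in\mathbb{R}^{n\times m}$ and $T=[t^1\;\cdots\;t^k]\in\mathbb{R}^{n\times k}$ have full row rank, and let $B(x^0+s^i;\Delta_T)\subset B(x^0;\overline{\Delta})$ for all $i\in\{1,\dots,m\}$. Then for any $p\in\mathbb{N}\setminus\{1\}$ (that is, any integer $p\ge2$), $$\|\nabla^2_{sc}f^p(x^0;S,T)-\nabla^2f^p(x^0)\|\le\left(pE_{\nabla_s^2 f}|f^{p-1}(x^0)|+p(p-1)E_{\nabla_s f}|f^{p-2}(x^0)|M^s_{f^p}\right)\Delta_u,$$ where $$M^s_{f^p}=\min\{E_{\nabla_s f}\Delta_u+2\|\nabla f(x^0)\|,\ \|\nabla_s f(x^0;T)\|+\|\nabla f(x^0)\|\}.$$ Moreover, if $\mathcal{S}(x^0;S,T)$ is poised for quadratic interpolation, then $$\|\nabla^2_{qc}f^p(x^0;S,T)-\nabla^2f^p(x^0)\|\le\left(pE_{\nabla_s^2 f}|f^{p-1}(x^0)|+p(p-1)E_{\nabla Q_f}|f^{p-2}(x^0)|M^q_{f^p}\Delta_u\right)\Delta_u,$$ where $$M^q_{f^p}=\min\{E_{\nabla Q_f}\Delta_u^2+2\|\nabla f(x^0)\|,\ \|\nabla Q_f(x^0;S,T)(x^0)\|+\|\nabla f(x^0)\|\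}.$$
   Context: Notation. $f^p$ is the $p$-th power of $f$ (with $f^0=1$). $B(x;r)$ is the open Euclidean ball of radius $r$ centred at $x$; vector norms are Euclidean, matrix norms the induced 2-norm; $\dagger$ is the Moore--Penrose pseudoinverse. $\Delta_S=\max_i\|s^i\|$, $\Delta_T=\max_j\|t^j\|$, $\Delta_u=\max\{\Delta_S,\Delta_T\}$, $\Delta_l=\min\{\Delta_S,\Delta_T\}$, $\widehat{S}=S/\Delta_S$, $\widehat{T}=T/\Delta_T$. $L_{\nabla f}$ and $L_{\nabla^2 f}$ denote the Lipschitz constants of $\nabla f$ and $\nabla^2 f$ on $B(x^0;\overline{\Delta})$. Generalized simplex gradient: $\nabla_s f(x;T)=(T^\top)^\dagger\big(f(x+t^j)-f(x)\big)_{j=1}^k$. Nested-set Hessian: $\nabla_s^2 f(x^0;S,T)=(S^\top)^\dagger\delta_{\nabla_s f}(x^0;S,T)$, where the $i$-th row of $\delta_{\nabla_s f}(x^0;S,T)\in\mathbb{R}^{m\times n}$ is $(\nabla_s f(x^0+s^i;T)-\nabla_s f(x^0;T))^\top$. $\mathcal{S}(x^0;S,T)=\{x^0\}\cup\{x^0+s^i\}_i\cup\{x^0+t^j\}_j\cup\{x^0+s^i+t^j\}_{i,j}$ is the set of distinct points used in this computation. A set of distinct points $\{y^0,\dots,y^q\}\subset\mathbb{R}^n$ with $q=\frac12(n+1)(n+2)-1$ is poised for quadratic interpolation if the system $\alpha_0+\alpha^\top y^i+\frac12(y^i)^\top\mathbf{H}y^i=0$, $i=0,\dots,q$, has a unique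 solution $\alpha_0\in\mathbb{R}$, $\alpha\in\mathbb{R}^n$, $\mathbf{H}=\mathbf{H}^\top\in\mathbb{R}^{n\times n}$. When $\mathcal{S}(x^0;S,T)$ is poised for quadratic interpolation, $Q_f(x^0;S,T)$ is the unique quadratic function $x\mapsto\alpha_0+\alpha^\top x+\frac12x^\top\mathbf{H}x$ ($\mathbf{H}$ symmetric) agreeing with $f$ on $\mathcal{S}(x^0;S,T)$, and $\nabla Q_f(x^0;S,T)(x^0)$ is its gradient at $x^0$. Simplex calculus Hessian and quadratic calculus Hessian of a power (with $f$ evaluated at $x^0$, $\nabla_s f=\nabla_s f(x^0;T)$, $\nabla_s^2 f=\nabla_s^2f(x^0;S,T)$, $\nabla Q_f=\nabla Q_f(x^0;S,T)(x^0)$): $$\nabla^2_{sc}f^p(x^0;S,T)=pf^{p-1}\nabla_s^2 f+p(p-1)f^{p-2}\nabla_s f(\nabla_s f)^\top,$$ $$\nabla^2_{qc}f^p(x^0;S,T)=pf^{p-1}\nabla_s^2 f+p(p-1)f^{p-2}\nabla Q_f(\nabla Q_f)^\top.$$ Error constants: $$E_{\nabla_s f}=\frac{\sqrt{k}}{2}L_{\nabla f}\left\|(\widehat{T}^\top)^\dagger\right\|,\qquad E_{\nabla_s^2 f}=\frac{m\sqrt{k}}{3}L_{\nabla^2 f}\left(2\frac{\Delta_u}{\Delta_l}+3\right)\left\|(\widehat{S}^\top)^\dagger\right\|\left\|\widehat{T}^\dagger\right\|,$$ $$E_{\nabla Q_f}=6(1+\sqrt2)\sqrt{q}\,L_{\nabla^2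 f}\left\|\widehat{Q}^{-1}\right\|.$$ Here $q=\frac12(n+1)(n+2)-1$ and, writing $\mathcal{S}(x^0;S,T)=\{y^0=x^0,y^1,\dots,y^q\}$ and $z^i=(y^i-x^0)/(\Delta_S+\Delta_T)$, $\widehat{Q}\in\mathbb{R}^{q\times q}$ is the matrix whose $i$-th row ($i=1,\dots,q$) consists of $z^i_1,\dots,z^i_n$, followed by $\frac12(z^i_1)^2,\dots,\frac12(z^i_n)^2$, followed by the products $z^i_a z^i_b$ for $1\le a<b\le n$; it is invertible when $\mathcal{S}(x^0;S,T)$ is poised for quadratic interpolation.
   Formalization: The formal theorem also assumes that f(y) tends to f(x^0+s^i+t^j) as y tends to x^0+s^i+t^j within the open ball B(x^0;Δ̄), for all i, j; without it the claim fails when such a point lies on the boundary of the ball and f jumps there. *)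

(* Defs.v *)
From HB Require Import structures.
From mathcomp Require Import all_boot all_order all_algebra.
From mathcomp Require Import all_classical all_reals all_analysis.

Set Implicit Arguments.
Unset Strict Implicit.
Unset Printing Implicit Defensive.

Import Order.TTheory GRing.Theory Num.Theory.
Import numFieldNormedType.Exports.

Local Open Scope classical_set_scope.
Local Open Scope ring_scope.

(* Euclidean norm; the library norm [`|x|] on matrices is the sup norm, so it is
   not used here (both induce the same topology). *)
Definition enorm (R : realType) (n : nat) (x : 'cV[R]_n) : R :=
  Num.sqrt (\sum_(i < n) x i 0 ^+ 2).

Definition eball (R : realType) (n : nat) (x : 'cV[R]_n) (r : R) :
    set 'cV[R]_n :=
  [set y | enorm (y - x) < r].

(* Matrix norm induced by the Euclidean vector norms. *)
Definition opnorm (R : realType) (m n : nat) (A : 'M[R]_(m, n)) : R :=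
  sup [set enorm (A *m x) | x in [set x : 'cV[R]_n | enorm x <= 1]].

Definition is_pseudoinverse (R : realType) (m n : nat)
    (A : 'M[R]_(m, n)) (B : 'M[R]_(n, m)) : Prop :=
  [/\ A *m B *m A = A, B *m A *m B = B,
      (A *m B)^T = A *m B & (B *m A)^T = B *m A].

(* Moore--Penrose pseudoinverse (unlike mathcomp's [pinvmx], which is only a
   partial inverse). *)
Definition mpinv (R : realType) (m n : nat) (A : 'M[R]_(m, n)) : 'M[R]_(n, m) :=
  xget 0 [set B | is_pseudoinverse A B].

Definition partial (R : realType) (n : nat) (i : 'I_n) (f : 'cV[R]_n -> R) :
    'cV[R]_n -> R :=
  fun x => 'D_(delta_mx i 0) f x.

(* Meant for open sets A. *)
Fixpoint continuously_differentiable (R : realType) (n : nat) (k : nat)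
    (A : set 'cV[R]_n) (f : 'cV[R]_n -> R) : Prop :=
  match k with
  | 0%N => forall x, A x -> {for x, continuous f}
  | k'.+1 => (forall x, A x -> differentiable f x) /\
             (forall i, continuously_differentiable k' A (partial i f))
  end.

Definition grad (R : realType) (n : nat) (f : 'cV[R]_n -> R) (x : 'cV[R]_n) :
    'cV[R]_n :=
  \col_i partial i f x.

Definition hess (R : realType) (n : nat) (f : 'cV[R]_n -> R) (x : 'cV[R]_n) :
    'M[R]_n :=
  \matrix_(i, j) partial i (partial j f) x.

Definition lipschitz_grad (R : realType) (n : nat) (A : set 'cV[R]_n)
    (f : 'cV[R]_n -> R) (L : R) : Prop :=
  forall x y, A x -> A y -> enorm (grad f x - grad f y) <= L * enorm (x - y).

Definition lipschitz_hess (R : realType) (n : nat) (A : set 'cV[R]_n)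
    (f : 'cV[R]_n -> R) (L : R) : Prop :=
  forall x y, A x -> A y -> opnorm (hess f x - hess f y) <= L * enorm (x - y).

(* Delta_S in the usual notation. *)
Definition col_radius (R : realType) (n m : nat) (S : 'M[R]_(n, m)) : R :=
  \big[Num.max/0]_(i < m) enorm (col i S).

Definition Delta_u (R : realType) (n m k : nat)
    (S : 'M[R]_(n, m)) (T : 'M[R]_(n, k)) : R :=
  Num.max (col_radius S) (col_radius T).

Definition Delta_l (R : realType) (n m k : nat)
    (S : 'M[R]_(n, m)) (T : 'M[R]_(n, k)) : R :=
  Num.min (col_radius S) (col_radius T).

Definition normalized (R : realType) (n m : nat) (S : 'M[R]_(n, m)) :
    'M[R]_(n, m) :=
  (col_radius S)^-1 *: S.

Definition simplex_grad (R : realType) (n k : nat) (f : 'cV[R]_n -> R)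
    (x : 'cV[R]_n) (T : 'M[R]_(n, k)) : 'cV[R]_n :=
  mpinv T^T *m \col_(j < k) (f (x + col j T) - f x).

Definition nested_hess (R : realType) (n m k : nat) (f : 'cV[R]_n -> R)
    (x0 : 'cV[R]_n) (S : 'M[R]_(n, m)) (T : 'M[R]_(n, k)) : 'M[R]_n :=
  mpinv S^T *m
  \matrix_(i < m, j < n)
    (simplex_grad f (x0 + col i S) T - simplex_grad f x0 T) j 0.

Definition sample_set (R : realType) (n m k : nat) (x0 : 'cV[R]_n)
    (S : 'M[R]_(n, m)) (T : 'M[R]_(n, k)) : set 'cV[R]_n :=
  [set x0] `|` [set y | exists i, y = x0 + col i S]
           `|` [set y | exists j, y = x0 + col j T]
           `|` [set y | exists i j, y = x0 + col i S + col j T].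

(* The quadratic function with coefficients c = (alpha_0, alpha, H). *)
Definition quadratic (R : realType) (n : nat)
    (c : R * 'cV[R]_n * 'M[R]_n) (x : 'cV[R]_n) : R :=
  c.1.1 + (c.1.2^T *m x) 0 0 + 2^-1 * (x^T *m c.2 *m x) 0 0.

Definition quad_size (n : nat) : nat := ((n.+1 * n.+2) %/ 2 - 1)%N.

Definition poised (R : realType) (n : nat) (A : set 'cV[R]_n) : Prop :=
  (exists y : 'I_(quad_size n).+1 -> 'cV[R]_n, injective y /\ range y = A) /\
  exists! c : R * 'cV[R]_n * 'M[R]_n,
    c.2^T = c.2 /\ forall y, A y -> quadratic c y = 0.

(* Q_f: the quadratic function agreeing with f on A; it is unique when A is
   poised. *)
Definition quad_interp (R : realType) (n : nat) (f : 'cV[R]_n -> R)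
    (A : set 'cV[R]_n) : 'cV[R]_n -> R :=
  xget (cst 0) [set Q | (exists c : R * 'cV[R]_n * 'M[R]_n,
                           c.2^T = c.2 /\ Q = quadratic c) /\
                        forall y, A y -> Q y = f y].

Definition grad_quad (R : realType) (n m k : nat) (f : 'cV[R]_n -> R)
    (x0 : 'cV[R]_n) (S : 'M[R]_(n, m)) (T : 'M[R]_(n, k)) : 'cV[R]_n :=
  grad (quad_interp f (sample_set x0 S T)) x0.

Definition simplex_calc_hess (R : realType) (n m k : nat) (f : 'cV[R]_n -> R)
    (p : nat) (x0 : 'cV[R]_n) (S : 'M[R]_(n, m)) (T : 'M[R]_(n, k)) :
    'M[R]_n :=
  (p%:R * f x0 ^+ (p - 1)) *: nested_hess f x0 S T +
  ((p * (p - 1))%:R * f x0 ^+ (p - 2)) *: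
    (simplex_grad f x0 T *m (simplex_grad f x0 T)^T).

Definition quad_calc_hess (R : realType) (n m k : nat) (f : 'cV[R]_n -> R)
    (p : nat) (x0 : 'cV[R]_n) (S : 'M[R]_(n, m)) (T : 'M[R]_(n, k)) :
    'M[R]_n :=
  (p%:R * f x0 ^+ (p - 1)) *: nested_hess f x0 S T +
  ((p * (p - 1))%:R * f x0 ^+ (p - 2)) *:
    (grad_quad f x0 S T *m (grad_quad f x0 S T)^T).

Definition E_simplex_grad (R : realType) (n k : nat) (L1 : R)
    (T : 'M[R]_(n, k)) : R :=
  Num.sqrt k%:R / 2 * L1 * opnorm (mpinv (normalized T)^T).

Definition E_nested_hess (R : realType) (n m k : nat) (L2 : R)
    (S : 'M[R]_(n, m)) (T : 'M[R]_(n, k)) : R :=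
  m%:R * Num.sqrt k%:R / 3 * L2 *
  (2 * (Delta_u S T / Delta_l S T) + 3) *
  opnorm (mpinv (normalized S)^T) * opnorm (mpinv (normalized T)).

Definition quad_row (R : realType) (n : nat) (z : 'cV[R]_n) : seq R :=
  [seq z a 0 | a <- enum 'I_n] ++
  [seq 2^-1 * z a 0 ^+ 2 | a <- enum 'I_n] ++
  [seq z ab.1 0 * z ab.2 0 |
     ab : 'I_n * 'I_n <- enum {: 'I_n * 'I_n} & (ab.1 < ab.2)%N].

(* Row i (counted from 0) is built from y^(i+1): [lift ord0 i] is i+1. *)
Definition Qhat (R : realType) (n m k : nat)
    (S : 'M[R]_(n, m)) (T : 'M[R]_(n, k))
    (y : 'I_(quad_size n).+1 -> 'cV[R]_n) : 'M[R]_(quad_size n) :=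
  \matrix_(i, j)
    nth 0 (quad_row ((col_radius S + col_radius T)^-1 *:
                       (y (lift ord0 i) - y ord0))) j.

Definition E_grad_quad (R : realType) (n m k : nat) (L2 : R)
    (S : 'M[R]_(n, m)) (T : 'M[R]_(n, k))
    (y : 'I_(quad_size n).+1 -> 'cV[R]_n) : R :=
  6 * (1 + Num.sqrt 2) * Num.sqrt (quad_size n)%:R * L2 *
  opnorm (invmx (Qhat S T y)).

Definition M_simplex (R : realType) (n m k : nat) (f : 'cV[R]_n -> R) (L1 : R)
    (x0 : 'cV[R]_n) (S : 'M[R]_(n, m)) (T : 'M[R]_(n, k)) : R :=
  Num.min
    (E_simplex_grad L1 T * Delta_u S T + 2 * enorm (grad f x0))
    (enorm (simplex_grad f x0 T) + enorm (grad f x0)).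

Definition M_quad (R : realType) (n m k : nat) (f : 'cV[R]_n -> R) (L2 : R)
    (x0 : 'cV[R]_n) (S : 'M[R]_(n, m)) (T : 'M[R]_(n, k))
    (y : 'I_(quad_size n).+1 -> 'cV[R]_n) : R :=
  Num.min
    (E_grad_quad L2 S T y * Delta_u S T ^+ 2 + 2 * enorm (grad f x0))
    (enorm (grad_quad f x0 S T) + enorm (grad f x0)).

(* Main.v *)
Require Import Defs.
From HB Require Import structures.
From mathcomp Require Import all_boot all_order all_algebra.
From mathcomp Require Import all_classical all_reals all_analysis.
From mathcomp Require Import ring lra zify.
Import Order.TTheory GRing.Theory Num.Theory.
Import numFieldNormedType.Exports.
Local Open Scope classical_set_scope.
Local Open Scope ring_scope.

(** By the product rule,
    [hess (f ^ p) = p f^(p-1) hess f + p (p - 1) f^(p-2) grad f (grad f)^T], and both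
    approximations replace [hess f] by the nested-set Hessian and [grad f] by some
    vector [u]. As [u u^T - v v^T = (u - v) u^T + v (u - v)^T], the error of the
    outer product is at most [|u - v| (|u| + |v|)], and [|u| <= |u - v| + |v|] gives
    the other argument of the minimum ([power_hess_error]). It remains to bound three
    errors at [x0].

    Simplex gradient and nested-set Hessian ([simplex_grad_error],
    [nested_hess_error]). The pseudoinverse of [T^T] is a left inverse of [T^T], so
    the error of the simplex gradient is the image under the pseudoinverse of the
    first order Taylor remainders. In the same way the error of the nested-set Hessian
    is obtained by applying both pseudoinverses to the matrix of second differences
    [f (x0 + s + t) - f (x0 + s) - f (x0 + t) + f x0 - s . (hess f x0) t]. Each of
    these is at most [L2 |s| |t| (|s| + |t|) / 2] ([second_difference_le]): integrate
    twice the bound of the Lipschitz condition, first in the direction [s], then in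
    the direction [t]. The normalization of [S] and [T] accounts for the powers
    of the radii.

    Quadratic interpolant ([grad_quad_error]). At a sample point the difference between
    the interpolant and the second order Taylor polynomial is a Taylor remainder, of
    order [D^3] with [D] the sum of the two radii. The coefficients of this difference
    thus solve a linear system with matrix [Qhat], and the norm of the inverse of [Qhat]
    bounds them; the gradients differ by [1 / D] times the first [n] of them.
    Poisedness makes [Qhat] invertible, since a vector of its kernel is a quadratic
    function that vanishes at all sample points.

    The points [x0 + s + t] may lie on the boundary of the ball. Every integration is
    therefore done along a segment that stays in the open ball before its end, and
    uses at the end only that [f] is the limit of its values inside the ball
    ([increment_le], [line_cvg_left]). *)

Set Implicit Arguments.
Unset Strict Implicit.
Unset Printing Implicit Defensive.

(** * Euclidean norm and induced matrix norm *)

Section Euclidean.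
Context {R : realType}.

Definition dot (n : nat) (x y : 'cV[R]_n) : R := \sum_(i < n) x i 0 * y i 0.

Lemma dotE n (x y : 'cV[R]_n) : (x^T *m y) 0 0 = dot x y.
Proof. by rewrite mxE; apply: eq_bigr => i _; rewrite mxE. Qed.

Lemma dotC n (x y : 'cV[R]_n) : dot x y = dot y x.
Proof. by apply: eq_bigr => i _; rewrite mulrC. Qed.

Lemma dotDr n (x y z : 'cV[R]_n) : dot x (y + z) = dot x y + dot x z.
Proof. by rewrite -big_split; apply: eq_bigr => i _; rewrite mxE mulrDr. Qed.

Lemma dotZr n a (x y : 'cV[R]_n) : dot x (a *: y) = a * dot x y.
Proof. by rewrite mulr_sumr; apply: eq_bigr => i _; rewrite mxE mulrCA. Qed.

Lemma dotDl n (x y z : 'cV[R]_n) : dot (y + z) x = dot y x + dot z x.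
Proof. by rewrite dotC dotDr !(dotC x). Qed.

Lemma dotZl n a (x y : 'cV[R]_n) : dot (a *: y) x = a * dot y x.
Proof. by rewrite dotC dotZr dotC. Qed.

Lemma dotBr n (x y z : 'cV[R]_n) : dot x (y - z) = dot x y - dot x z.
Proof. by rewrite -scaleN1r dotDr dotZr mulN1r. Qed.

Lemma dotBl n (x y z : 'cV[R]_n) : dot (y - z) x = dot y x - dot z x.
Proof. by rewrite dotC dotBr !(dotC x). Qed.

Lemma dot_mulmx m n (A : 'M[R]_(m, n)) x y :
  dot (A *m x) y = dot x (A^T *m y).
Proof. by rewrite -!dotE trmx_mul mulmxA. Qed.

Lemma enorm_sqr n (x : 'cV[R]_n) : enorm x ^+ 2 = dot x x.
Proof.
rewrite sqr_sqrtr; last by apply: sumr_ge0 => i _; exact: sqr_ge0.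
by apply: eq_bigr => i _; rewrite expr2.
Qed.

Lemma enorm_ge0 n (x : 'cV[R]_n) : 0 <= enorm x.
Proof. exact: sqrtr_ge0. Qed.

Lemma enorm_le_sqr n (x : 'cV[R]_n) c : 0 <= c ->
  (enorm x <= c) = (dot x x <= c ^+ 2).
Proof. by move=> c0; rewrite -enorm_sqr ler_pXn2r ?nnegrE ?enorm_ge0. Qed.

Lemma coord_le_enorm n (x : 'cV[R]_n) i : `|x i 0| <= enorm x.
Proof.
rewrite -sqrtr_sqr; apply: ler_wsqrtr.
by rewrite (bigD1 i) //= lerDl; apply: sumr_ge0 => j _; exact: sqr_ge0.
Qed.

Lemma enorm_eq0 n (x : 'cV[R]_n) : enorm x = 0 -> x = 0.
Proof.
move=> x0; apply/colP => i; rewrite mxE; apply/normr0_eq0/le_anti.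
by rewrite normr_ge0 -x0 coord_le_enorm.
Qed.

Lemma dot_eq0 n (x : 'cV[R]_n) : dot x x = 0 -> x = 0.
Proof. by move/eqP; rewrite -enorm_sqr sqrf_eq0 => /eqP/enorm_eq0. Qed.

Lemma enormZ n a (x : 'cV[R]_n) : enorm (a *: x) = `|a| * enorm x.
Proof.
apply/eqP; rewrite -(@eqrXn2 _ 2) ?mulr_ge0 ?enorm_ge0 //.
by rewrite exprMn !enorm_sqr dotZl dotZr mulrA -expr2 real_normK ?num_real.
Qed.

Lemma enorm0 n : enorm (0 : 'cV[R]_n) = 0.
Proof. by rewrite -(scale0r 0) enormZ normr0 mul0r. Qed.

Lemma enormN n (x : 'cV[R]_n) : enorm (- x) = enorm x.
Proof. by rewrite -scaleN1r enormZ normrN1 mul1r. Qed.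

(** Expanding the squared norm of [|y| x - |x| y], which is nonnegative. *)
Lemma dot_le n (x y : 'cV[R]_n) : dot x y <= enorm x * enorm y.
Proof.
have [/eqP x0|x0] := boolP (enorm x == 0).
  rewrite x0 mul0r (enorm_eq0 x0) -(scale0r 0) dotZl mul0r //.
have [/eqP y0|y0] := boolP (enorm y == 0).
  rewrite y0 mulr0 (enorm_eq0 y0) -(scale0r 0) dotZr mul0r //.
have xy0 : 0 < enorm x * enorm y.
  by rewrite mulr_gt0 // lt_neqAle eq_sym ?x0 ?y0 enorm_ge0.
have := sqr_ge0 (enorm (enorm y *: x - enorm x *: y)).
rewrite enorm_sqr dotBl !dotBr !dotZl !dotZr -!enorm_sqr (dotC y x) => h.
rewrite -subr_ge0 -(pmulr_rge0 _ xy0); move: h.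
set a := enorm x; set b := enorm y; set d := dot x y; lra.
Qed.

Lemma normr_dot_le n (x y : 'cV[R]_n) : `|dot x y| <= enorm x * enorm y.
Proof.
rewrite ler_norml dot_le andbT lerNl -mulN1r -dotZl scaleN1r.
by apply: le_trans (dot_le _ _) _; rewrite enormN.
Qed.

Lemma enormD n (x y : 'cV[R]_n) : enorm (x + y) <= enorm x + enorm y.
Proof.
rewrite enorm_le_sqr ?addr_ge0 ?enorm_ge0 // dotDl !dotDr (dotC y x) -!enorm_sqr.
have := dot_le x y; lra.
Qed.

Lemma enorm_le_coord n (x : 'cV[R]_n) a : 0 <= a ->
  (forall i, `|x i 0| <= a) -> enorm x <= Num.sqrt n%:R * a.
Proof.
move=> a0 xa; rewrite enorm_le_sqr ?mulr_ge0 ?sqrtr_ge0 //.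
rewrite exprMn sqr_sqrtr ?ler0n // mulr_natl.
rewrite -{2}(card_ord n) -sumr_const; apply: ler_sum => i _.
by rewrite -expr2 -real_normK ?num_real // ler_pXn2r ?nnegrE.
Qed.

(** [opnorm] is a [sup], hence meaningful only once its set is known to be bounded;
    Cauchy-Schwarz on each row gives a bound. *)
Lemma opnorm_has_sup m n (A : 'M[R]_(m, n)) :
  has_sup [set enorm (A *m x) | x in [set x : 'cV[R]_n | enorm x <= 1]].
Proof.
split; first by exists (enorm (A *m 0)), 0; rewrite //= enorm0 ler01.
exists (Num.sqrt m%:R * \sum_i enorm (row i A)^T) => _ [x /= x1 <-].
have S0 : 0 <= \sum_i enorm (row i A)^T by apply: sumr_ge0 => i _; exact: enorm_ge0.
apply: enorm_le_coord => // i.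
have -> : (A *m x) i 0 = dot (row i A)^T x.
  by rewrite mxE; apply: eq_bigr => j _; rewrite !mxE.
apply: le_trans (normr_dot_le _ _) _.
apply: (@le_trans _ _ (enorm (row i A)^T)).
  by rewrite ler_piMr ?enorm_ge0.
by rewrite (bigD1 i) //= lerDl; apply: sumr_ge0 => j _; exact: enorm_ge0.
Qed.

Lemma opnorm_ge0 m n (A : 'M[R]_(m, n)) : 0 <= opnorm A.
Proof.
apply: (le_trans (enorm_ge0 (A *m 0))).
by apply: ub_le_sup; [exact: (opnorm_has_sup A).2|exists 0; rewrite //= enorm0 ler01].
Qed.

Lemma enorm_mulmx m n (A : 'M[R]_(m, n)) x :
  enorm (A *m x) <= opnorm A * enorm x.
Proof.
have [/eqP x0|x0] := boolP (enorm x == 0).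
  by rewrite x0 (enorm_eq0 x0) mulmx0 enorm0 mulr0.
have xp : 0 < enorm x by rewrite lt_neqAle eq_sym x0 enorm_ge0.
rewrite -ler_pdivrMr // mulrC -{1}(ger0_norm (enorm_ge0 x)) -normfV -enormZ scalemxAr.
apply: ub_le_sup; first exact: (opnorm_has_sup A).2.
exists ((enorm x)^-1 *: x) => //=.
by rewrite enormZ normfV ger0_norm ?enorm_ge0 // mulVf.
Qed.

Lemma opnorm_le m n (A : 'M[R]_(m, n)) c : 0 <= c ->
  (forall x, enorm (A *m x) <= c * enorm x) -> opnorm A <= c.
Proof.
move=> c0 Ac; apply: ge_sup; first exact: (opnorm_has_sup A).1.
by move=> _ [x /= x1 <-]; apply: le_trans (Ac x) _; rewrite ler_piMr.
Qed.

Lemma opnormM m n k (A : 'M[R]_(m, n)) (B : 'M[R]_(n, k)) :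
  opnorm (A *m B) <= opnorm A * opnorm B.
Proof.
apply: opnorm_le; first by rewrite mulr_ge0 ?opnorm_ge0.
move=> x; rewrite -mulmxA -mulrA; apply: le_trans (enorm_mulmx _ _) _.
by rewrite ler_wpM2l ?opnorm_ge0 ?enorm_mulmx.
Qed.

Lemma opnormD m n (A B : 'M[R]_(m, n)) : opnorm (A + B) <= opnorm A + opnorm B.
Proof.
apply: opnorm_le; first by rewrite addr_ge0 ?opnorm_ge0.
move=> x; rewrite mulmxDl mulrDl; apply: le_trans (enormD _ _) _.
by rewrite lerD ?enorm_mulmx.
Qed.

Lemma opnormZ_le m n a (A : 'M[R]_(m, n)) : opnorm (a *: A) <= `|a| * opnorm A.
Proof.
apply: opnorm_le; first by rewrite mulr_ge0 ?opnorm_ge0.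
by move=> x; rewrite -scalemxAl enormZ -mulrA ler_wpM2l ?enorm_mulmx.
Qed.

Lemma normr_dot_mulmx m n (A : 'M[R]_(m, n)) x y :
  `|dot x (A *m y)| <= opnorm A * (enorm x * enorm y).
Proof.
apply: le_trans (normr_dot_le _ _) _.
by rewrite mulrCA ler_wpM2l ?enorm_ge0 ?enorm_mulmx.
Qed.

(** The bilinear form [x, y |-> x . A y] bounds [|A^T x|^2] on [y = A^T x]. *)
Lemma opnorm_tr_le m n (A : 'M[R]_(m, n)) : opnorm A^T <= opnorm A.
Proof.
apply: opnorm_le; first exact: opnorm_ge0.
move=> x; have [/eqP ->|x0] := boolP (enorm (A^T *m x) == 0).
  by rewrite mulr_ge0 ?opnorm_ge0 ?enorm_ge0.
have xp : 0 < enorm (A^T *m x) by rewrite lt_neqAle eq_sym x0 enorm_ge0.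
rewrite -(ler_pM2r xp) -expr2 enorm_sqr dot_mulmx trmxK -mulrA.
exact: le_trans (ler_norm _) (normr_dot_mulmx _ _ _).
Qed.

Lemma opnorm_tr m n (A : 'M[R]_(m, n)) : opnorm A^T = opnorm A.
Proof.
by apply/le_anti; rewrite opnorm_tr_le -{1}(trmxK A) opnorm_tr_le.
Qed.

Lemma opnorm_le_row m n (A : 'M[R]_(m, n)) c : 0 <= c ->
  (forall i, enorm (row i A)^T <= c) -> opnorm A <= Num.sqrt m%:R * c.
Proof.
move=> c0 Ac; apply: opnorm_le; first by rewrite mulr_ge0 ?sqrtr_ge0.
move=> x; rewrite -mulrA; apply: enorm_le_coord; first by rewrite mulr_ge0 ?enorm_ge0.
move=> i; have -> : (A *m x) i 0 = dot (row i A)^T x.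
  by rewrite mxE; apply: eq_bigr => j _; rewrite !mxE.
by apply: le_trans (normr_dot_le _ _) _; rewrite ler_wpM2r ?enorm_ge0.
Qed.

(** [u u^T - v v^T = (u - v) u^T + v (u - v)^T]. *)
Lemma opnorm_outer_sub n (u v : 'cV[R]_n) :
  opnorm (u *m u^T - v *m v^T) <= enorm (u - v) * (enorm u + enorm v).
Proof.
apply: opnorm_le; first by rewrite mulr_ge0 ?addr_ge0 ?enorm_ge0.
move=> x.
have outerE (a b : 'cV[R]_n) : a *m b^T *m x = dot b x *: a.
  rewrite -mulmxA; apply/colP => i.
  by rewrite mxE big_ord1 -dotE mulrC [RHS]mxE.
have -> : (u *m u^T - v *m v^T) *m x = dot u x *: (u - v) + dot (u - v) x *: v.
  rewrite mulmxBl !outerE dotBl scalerBr scalerBl addrA.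
  by rewrite subrK.
apply: le_trans (enormD _ _) _; rewrite !enormZ.
have := ler_wpM2r (enorm_ge0 (u - v)) (normr_dot_le u x).
have := ler_wpM2r (enorm_ge0 v) (normr_dot_le (u - v) x).
lra.
Qed.

End Euclidean.

(** * Pseudoinverses of matrices with full row rank *)

Section Pseudoinverse.
Context {R : realType}.

(** Each of the two candidates absorbs the other: the symmetry conditions let
    the factors be exchanged. *)
Lemma pseudoinverse_uniq m n (A : 'M[R]_(m, n)) B C :
  is_pseudoinverse A B -> is_pseudoinverse A C -> B = C.
Proof.
case=> ABA BAB ABs BAs [ACA CAC ACs CAs].
have AB : A *m B = A *m C.
  by rewrite -ABs -{1}ACA -(mulmxA (A *m C)) trmx_mul ABs ACs mulmxA ABA.
have BA : B *m A = C *m A.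
  by rewrite -BAs -{1}ACA -mulmxA mulmxA trmx_mul BAs CAs -mulmxA (mulmxA A) ABA.
by rewrite -BAB BA -mulmxA AB mulmxA CAC.
Qed.

Lemma mpinv_eq m n (A : 'M[R]_(m, n)) B : is_pseudoinverse A B -> mpinv A = B.
Proof.
move=> AB; apply: (@pseudoinverse_uniq _ _ A) => //.
exact: (@xgetI _ 0 [set B | is_pseudoinverse A B] B AB).
Qed.

Lemma pseudoinverse_tr m n (A : 'M[R]_(m, n)) B :
  is_pseudoinverse A B -> is_pseudoinverse A^T B^T.
Proof.
by case=> ABA BAB ABs BAs; split; rewrite -?trmx_mul ?trmxK //;
  rewrite -?mulmxA -?trmx_mul ?mulmxA ?ABA ?BAB.
Qed.

Lemma pseudoinverseZ m n (A : 'M[R]_(m, n)) B c : c != 0 ->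
  is_pseudoinverse A B -> is_pseudoinverse (c *: A) (c^-1 *: B).
Proof.
move=> c0 [ABA BAB ABs BAs]; split.
- by rewrite -!scalemxAl -!scalemxAr -scalemxAl ABA !scalerA; congr (_ *: _); field.
- by rewrite -!scalemxAl -!scalemxAr -scalemxAl BAB !scalerA; congr (_ *: _); field.
- by rewrite -!scalemxAl -!scalemxAr scalerA mulfV // scale1r.
- by rewrite -!scalemxAl -!scalemxAr scalerA mulVf // scale1r.
Qed.

(** Positivity of the Gram matrix: [x A A^T = 0] forces [|x A|^2 = 0]. *)
Lemma gram_unitmx m n (A : 'M[R]_(m, n)) : row_free A -> A *m A^T \in unitmx.
Proof.
move=> Afree; rewrite -row_free_unit -kermx_eq0.
apply/eqP/row_matrixP => i; rewrite row0.
have xAA : row i (kermx (A *m A^T)) *m (A *m A^T) = 0.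
  by rewrite -row_mul mulmx_ker row0.
apply/eqP; rewrite -(mulmx_free_eq0 _ Afree); apply/eqP.
apply: trmx_inj; rewrite trmx0; apply: dot_eq0.
by rewrite -dotE trmxK trmx_mul mulmxA -(mulmxA _ A) xAA mul0mx mxE.
Qed.

Lemma row_free_pseudoinverse m n (A : 'M[R]_(m, n)) : row_free A ->
  is_pseudoinverse A (A^T *m invmx (A *m A^T)).
Proof.
move=> /gram_unitmx Au.
have AB : A *m (A^T *m invmx (A *m A^T)) = 1%:M by rewrite mulmxA mulmxV.
split; first by rewrite AB mul1mx.
- by rewrite -mulmxA AB mulmx1.
- by rewrite AB trmx1.
- by rewrite !trmx_mul trmx_inv trmx_mul trmxK mulmxA.
Qed.

Lemma mpinv_tr m n (A : 'M[R]_(m, n)) : row_free A -> mpinv A^T = (mpinv A)^T.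
Proof.
move=> /row_free_pseudoinverse AB.
by rewrite (mpinv_eq (pseudoinverse_tr AB)) (mpinv_eq AB).
Qed.

Lemma mpinv_tr_mulmx m n (A : 'M[R]_(m, n)) :
  row_free A -> mpinv A^T *m A^T = 1%:M.
Proof.
move=> Afree; rewrite mpinv_tr // -trmx_mul.
by rewrite (mpinv_eq (row_free_pseudoinverse Afree)) mulmxA mulmxV ?gram_unitmx ?trmx1.
Qed.

Lemma col_radius_ge0 m n (A : 'M[R]_(m, n)) : 0 <= col_radius A.
Proof. exact: bigmax_ge_id. Qed.

Lemma enorm_col_le m n (A : 'M[R]_(m, n)) i : enorm (col i A) <= col_radius A.
Proof. exact: (le_bigmax _ (fun i => enorm (col i A))). Qed.

Lemma col_radius_gt0 m n (A : 'M[R]_(m, n)) : (0 < m)%N -> row_free A ->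
  0 < col_radius A.
Proof.
move=> m0 Afree; rewrite lt_neqAle col_radius_ge0 andbT eq_sym.
apply/negP => /eqP A0.
have A_eq0 : A = 0.
  apply/matrixP => i j; have := enorm_col_le A j; rewrite A0 => h.
  have /enorm_eq0/colP/(_ i) : enorm (col j A) = 0.
    by apply/le_anti; rewrite h enorm_ge0.
  by rewrite !mxE.
by move: Afree m0; rewrite /row_free A_eq0 mxrank0 => /eqP <-.
Qed.

(** The maximum in [col_radius] starts from the default value [0], so positivity
    ensures that some column attains it. *)
Lemma exists_col_radius m n (A : 'M[R]_(m, n)) : 0 < col_radius A ->
  exists i, enorm (col i A) = col_radius A.
Proof.
have [j|A0] := pickP (fun j => enorm (col j A) == col_radius A).
  by move=> /eqP jA _; exists j.
move=> r0; suff : col_radius A < col_radius A by rewrite ltxx.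
apply: bigmax_lt => // j _.
by rewrite lt_neqAle A0 enorm_col_le.
Qed.

Lemma mpinv_normalized_tr m n (A : 'M[R]_(m, n)) : (0 < m)%N -> row_free A ->
  mpinv (normalized A)^T = col_radius A *: mpinv A^T.
Proof.
move=> m0 Afree.
have := pseudoinverse_tr (row_free_pseudoinverse Afree) => AB.
rewrite (mpinv_eq AB) /normalized linearZ /= -{2}(invrK (col_radius A)).
apply: mpinv_eq; apply: pseudoinverseZ => //.
by rewrite invr_eq0 gt_eqF ?col_radius_gt0.
Qed.

(** This is where the powers of the radii in the error bounds come from: the
    pseudoinverse of the unscaled matrix is that of the normalized one divided by
    the radius. *)
Lemma opnorm_mpinv_tr m n (A : 'M[R]_(m, n)) : (0 < m)%N -> row_free A ->
  opnorm (mpinv A^T) <= opnorm (mpinv (normalized A)^T) / col_radius A.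
Proof.
move=> m0 Afree; have r0 := col_radius_gt0 m0 Afree.
have -> : mpinv A^T = (col_radius A)^-1 *: mpinv (normalized A)^T.
  by rewrite mpinv_normalized_tr // scalerA mulVf ?gt_eqF // scale1r.
apply: le_trans (opnormZ_le _ _) _.
by rewrite ger0_norm ?invr_ge0 ?(ltW r0) // mulrC.
Qed.

Lemma opnorm_mpinv_normalized m n (A : 'M[R]_(m, n)) : (0 < m)%N -> row_free A ->
  opnorm (mpinv (normalized A)) = opnorm (mpinv (normalized A)^T).
Proof.
move=> m0 Afree; have r0 := col_radius_gt0 m0 Afree.
have AB := pseudoinverseZ (invr_neq0 (lt0r_neq0 r0)) (row_free_pseudoinverse Afree).
by rewrite (mpinv_eq (pseudoinverse_tr AB)) (mpinv_eq AB) opnorm_tr.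
Qed.

End Pseudoinverse.

(** * Balls and restrictions to lines *)

Lemma addrDKl (V : zmodType) (x y : V) : x + y - x = y.
Proof. by rewrite addrC addKr. Qed.

Section Balls.
Context {R : realType}.

Lemma eball_open n (x0 x : 'cV[R]_n) r :
  eball x0 r x -> \forall y \near x, eball x0 r y.
Proof.
rewrite /eball /= => xr.
have enorm_cont : {for x, continuous (fun y : 'cV[R]_n => enorm (y - x0))}.
  rewrite /enorm => {xr}; apply: (@continuous_comp _ _ _
    (fun y : 'cV[R]_n => \sum_(i < n) (y - x0) i 0 ^+ 2) Num.sqrt); last first.
    exact: sqrt_continuous.
  move: x; apply: (@continuous_big _ _ _ _ _ _ _ _ (fun i (y : 'cV[R]_n) =>
    (y - x0) i 0 ^+ 2)) => [|i _ x]; first exact: add_continuous.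
  apply: (@continuous_comp _ _ _ (fun y : 'cV[R]_n => (y - x0) i 0)
    (fun z : R => z ^+ 2)); last exact: exprn_continuous.
  apply: (@continuous_comp _ _ _ (fun y : 'cV[R]_n => y - x0)
    (fun z : 'cV[R]_n => z i 0)); last exact: coord_continuous.
  by apply: continuousB; [exact: cvg_id|exact: cst_continuous].
exact: (cvgr_lt _ enorm_cont).
Qed.

Lemma eball_segment n (x0 a w : 'cV[R]_n) r v : 0 <= v <= 1 ->
  eball x0 r a -> eball x0 r (a + w) -> eball x0 r (a + v *: w).
Proof.
rewrite /eball /= => /andP[v0 v1] ar awr.
have -> : a + v *: w - x0 = (1 - v) *: (a - x0) + v *: (a + w - x0).
  apply/colP => i; rewrite !mxE; ring.
apply: le_lt_trans (enormD _ _) _; rewrite !enormZ (ger0_norm v0) ger0_norm ?subr_ge0 //.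
have [->|v_neq0] := eqVneq v 0; first by rewrite subr0 mul1r mul0r addr0.
have vp : 0 < v by rewrite lt_neqAle eq_sym v_neq0.
have h1 : 0 <= (1 - v) * (r - enorm (a - x0)) by rewrite mulr_ge0 ?subr_ge0 // ltW.
have h2 : 0 < v * (r - enorm (a + w - x0)) by rewrite mulr_gt0 ?subr_gt0.
lra.
Qed.

(** The ray leaves from the centre, so its end [x0 + w] may lie on the sphere. *)
Lemma eball_ray n (x0 w : 'cV[R]_n) r v : 0 < r -> 0 <= v -> v < 1 ->
  enorm w <= r -> eball x0 r (x0 + v *: w).
Proof.
move=> r0 v0 v1 wr; rewrite /eball /= addrDKl enormZ ger0_norm //.
by apply: (@le_lt_trans _ _ (v * r)); rewrite ?ler_wpM2l // gtr_pMl.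
Qed.

(** The larger ball has to contain the points of the smaller one that lie on
    the ray from [x0] through its centre. *)
Lemma eball_sub_radius n (x0 s : 'cV[R]_n) r D : (0 < n)%N -> 0 < r ->
  eball (x0 + s) r `<=` eball x0 D -> enorm s + r <= D.
Proof.
move=> n0 r0 sub; rewrite leNgt; apply/negP => Dlt.
pose rho := Num.max 0 (D - enorm s).
have rho0 : 0 <= rho by rewrite le_max lexx.
have rhor : rho < r by rewrite gt_max r0 ltrBlDl.
have rhoD : D <= enorm s + rho by rewrite -lerBlDl le_max lexx orbT.
have [e [e1 se]] : exists e : 'cV[R]_n, enorm e = 1 /\ s = enorm s *: e.
  have [/eqP s0|s0] := boolP (enorm s == 0).
    exists (delta_mx (Ordinal n0) 0); split; last by rewrite s0 scale0r (enorm_eq0 s0).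
    rewrite /enorm (bigD1 (Ordinal n0)) //= big1 ?mxE ?eqxx ?expr1n ?addr0 ?sqrtr1 //.
    by move=> i /negbTE i0; rewrite mxE i0 expr0n.
  exists ((enorm s)^-1 *: s); rewrite scalerA mulfV // scale1r; split=> //.
  by rewrite enormZ ger0_norm ?invr_ge0 ?enorm_ge0 // mulVf.
suff : eball x0 D (x0 + s + rho *: e).
  rewrite /eball /=; have -> : x0 + s + rho *: e - x0 = (enorm s + rho) *: e.
    by rewrite scalerDl -se addrAC [x0 + s]addrC addrK.
  by rewrite enormZ e1 mulr1 ger0_norm ?addr_ge0 ?enorm_ge0 // ltNge rhoD.
by apply: sub; rewrite /eball /= addrDKl enormZ e1 mulr1 ger0_norm.
Qed.

End Balls.

Section Lines.
Context {R : realType}.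

Lemma derive_grad n (f : 'cV[R]_n -> R) x w :
  differentiable f x -> 'D_w f x = dot (grad f x) w.
Proof.
move=> fx; rewrite deriveE // {1}(matrix_sum_delta w) linear_sum.
apply: eq_bigr => i _; rewrite big_ord1 linearZ /= mxE /partial deriveE //.
by rewrite mulrC.
Qed.

(** The difference quotients on both sides are the same function. *)
Lemma derive_lineE n (f : 'cV[R]_n -> R) a w (v : R) :
  (derivable (fun u : R => f (a + u *: w)) v 1 = derivable f (a + v *: w) w) *
  ('D_1 (fun u : R => f (a + u *: w)) v = 'D_w f (a + v *: w)).
Proof.
have shiftE : (fun h : R => h^-1 *: (((fun u => f (a + u *: w)) \o shift v) (h *: 1)
      - f (a + v *: w))) =
    (fun h : R => h^-1 *: ((f \o shift (a + v *: w)) (h *: w) - f (a + v *: w))).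
  apply/funext => h /=; congr (_ *: (f _ - _)).
  by rewrite [h%:A]mulr1 scalerDl addrCA.
by rewrite /derivable /derive shiftE.
Qed.

Lemma is_derive_line n (f : 'cV[R]_n -> R) a w v :
  differentiable f (a + v *: w) ->
  is_derive v 1 (fun u : R => f (a + u *: w)) (dot (grad f (a + v *: w)) w).
Proof.
move=> fx; apply: DeriveDef; rewrite derive_lineE; last exact: derive_grad.
exact: diff_derivable.
Qed.

Lemma is_derive_grad_line n (f : 'cV[R]_n -> R) a w t v :
  (forall j, differentiable (partial j f) (a + v *: w)) ->
  is_derive v 1 (fun u : R => dot (grad f (a + u *: w)) t)
    (dot w (hess f (a + v *: w) *m t)).
Proof.
move=> fx.
have -> : (fun u : R => dot (grad f (a + u *: w)) t) =
    \sum_(j < n) (t j 0 *: (fun u : R => partial j f (a + u *: w))).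
  apply/funext => u; rewrite fct_sumE; apply: eq_bigr => j _.
  by rewrite mxE mulrC.
have -> : dot w (hess f (a + v *: w) *m t) =
    \sum_(j < n) t j 0 *: dot (grad (partial j f) (a + v *: w)) w.
  rewrite /dot; under eq_bigr => i _ do rewrite mxE mulr_sumr.
  rewrite exchange_big; apply: eq_bigr => j _; rewrite scaler_sumr.
  apply: eq_bigr => i _; rewrite !mxE /GRing.scale /=; ring.
apply: is_derive_sum => j; apply: is_deriveZ; exact: is_derive_line.
Qed.

Lemma is_derive_continuous (h : R -> R) (v dh : R) : is_derive v 1 h dh ->
  {for v, continuous h}.
Proof. by move=> [/derivable1_diffP/differentiable_continuous]. Qed.

(** A limit within [B] is enough at the end of the segment, since the segment lies
    in [B] before its end; so the end may be a boundary point of [B]. *)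
Lemma line_cvg_left n (B : set 'cV[R]_n) (f : 'cV[R]_n -> R) a w :
  (forall v : R, 0 <= v -> v < 1 -> B (a + v *: w)) ->
  f @ within B (nbhs (a + w)) --> f (a + w) ->
  (fun v : R => f (a + v *: w)) @ 1^'- --> f (a + w).
Proof.
move=> Bl; apply: cvg_comp => A /= BA.
have line_cont : (fun v : R => a + v *: w) @ (1 : R) --> a + w.
  apply: cvgD; first exact: cvg_cst.
  rewrite -[X in _ --> X]scale1r; apply: cvgZr_tmp; exact: cvg_id.
have : \forall v \near (1 : R)^'-, B (a + v *: w) -> A (a + v *: w).
  by apply: cvg_within; exact: line_cont BA.
move=> BA1; near=> v; have : B (a + v *: w) -> A (a + v *: w) by near: v.
apply; apply: Bl => //; near: v; exact: nbhs_left_ge.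
Unshelve. all: by end_near. Qed.

Lemma within_continuous n (B : set 'cV[R]_n) (f : 'cV[R]_n -> R) b :
  differentiable f b -> f @ within B (nbhs b) --> f b.
Proof. by move/differentiable_continuous => fb; apply: cvg_within_filter. Qed.

(** Monotonicity of [v |-> h v - (a v + b v^2 / 2)]: this replaces integrating
    the bound on the derivative. *)
Lemma increment_le (h dh : R -> R) (a b : R) :
  (forall v : R, 0 <= v -> v < 1 -> is_derive v 1 h (dh v)) ->
  h @ 1^'- --> h 1 ->
  (forall v : R, 0 <= v -> v < 1 -> dh v <= a + b * v) ->
  h 1 - h 0 <= a + b / 2.
Proof.
move=> dh_h h1 dhab.
pose g v := h v - (a * v + b / 2 * v ^+ 2).
have dg (v : R) : 0 <= v -> v < 1 -> is_derive v 1 g (dh v - (a + b * v)).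
  move=> v0 v1; have ? := dh_h v v0 v1.
  rewrite /g; apply: is_derive_eq.
  by rewrite /GRing.scale /=; field.
have gc : {within `[0, 1], continuous g}.
  apply/continuous_within_itvP => //; split.
  - move=> v; rewrite in_itv /= => /andP[v0 v1].
    exact: is_derive_continuous (dg v (ltW v0) v1).
  - by apply: cvg_at_right_filter; exact: is_derive_continuous (dg 0 _ _).
  - apply: cvgB => //; apply: cvg_at_left_filter.
    apply: cvgD; first by apply: cvgMl_tmp; exact: cvg_id.
    by apply: cvgMl_tmp; exact: exprn_continuous.
have [|c] := @MVT R g (fun v => dh v - (a + b * v)) 0 1 ltr01 _ gc.
  by move=> v; rewrite in_itv /= => /andP[v0 v1]; exact: dg (ltW v0) v1.
rewrite in_itv /= => /andP[c0 c1]; rewrite /g => gE.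
have := dhab c (ltW c0) c1; move: gE; lra.
Qed.

Lemma normr_increment_le (h dh : R -> R) (a b : R) :
  (forall v : R, 0 <= v -> v < 1 -> is_derive v 1 h (dh v)) ->
  h @ 1^'- --> h 1 ->
  (forall v : R, 0 <= v -> v < 1 -> `|dh v| <= a + b * v) ->
  `|h 1 - h 0| <= a + b / 2.
Proof.
move=> dh_h h1 dhab; rewrite ler_norml; apply/andP; split.
  rewrite lerNl opprB addrC -{1}(opprK (h 0)).
  apply: (@increment_le (fun v => - h v) (fun v => - dh v)).
  - by move=> v v0 v1; have ? := dh_h v v0 v1; apply: is_deriveN.
  - exact: cvgN.
  - by move=> v v0 v1; apply: le_trans (dhab v v0 v1); rewrite -normrN ler_norm.
apply: (@increment_le h dh) => // v v0 v1.
by apply: le_trans (dhab v v0 v1); rewrite ler_norm.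
Qed.

Lemma mulr_cvg_left1 (c : R) : (fun v : R => v * c) @ 1^'- --> c.
Proof.
rewrite -[X in _ --> X]mul1r; apply: cvg_at_left_filter.
by apply: cvgMr_tmp; exact: cvg_id.
Qed.

Lemma is_derive_mulr_cst (c v : R) : is_derive v 1 (fun u : R => u * c) c.
Proof. by apply: is_derive_eq; rewrite /GRing.scale /=; ring. Qed.

End Lines.

(** * Taylor estimates and second differences *)

Section Increments.
Context {R : realType} (n : nat).
Implicit Types (f : 'cV[R]_n -> R) (x s t w : 'cV[R]_n) (r L : R).

Definition twice_differentiable_on (B : set 'cV[R]_n) f : Prop :=
  (forall x, B x -> differentiable f x) /\
  (forall j x, B x -> differentiable (partial j f) x).

(** A Lipschitz bound between two distinct points of the ball forces the constant to
    be nonnegative; both the gradient and the Hessian fit the function [d]. *)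
Lemma lipschitz_constant_ge0 x0 r L (d : 'cV[R]_n -> 'cV[R]_n -> R) :
  (0 < n)%N -> 0 < r -> (forall x y, 0 <= d x y) ->
  (forall x y, eball x0 r x -> eball x0 r y -> d x y <= L * enorm (x - y)) ->
  0 <= L.
Proof.
move=> n0 r0 d0 dL; pose e : 'cV[R]_n := delta_mx (Ordinal n0) 0.
have ep : 0 < enorm e.
  by apply: lt_le_trans (coord_le_enorm e (Ordinal n0)); rewrite mxE !eqxx normr1 ltr01.
have ce : eball x0 r (x0 + (r / (2 * enorm e)) *: e).
  rewrite /eball /= addrDKl enormZ ger0_norm ?divr_ge0 ?mulr_ge0 ?ltW //.
  have -> : r / (2 * enorm e) * enorm e = r / 2 by field; rewrite gt_eqF.
  lra.
have cc : eball x0 r x0 by rewrite /eball /= subrr enorm0.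
have := le_trans (d0 _ _) (dL _ _ ce cc).
rewrite addrDKl pmulr_lge0 // enormZ mulr_gt0 ?normr_gt0 //.
by rewrite gt_eqF // divr_gt0 // mulr_gt0.
Qed.

(** The integrand of the remainder [int_0^1 (grad f (x0 + v w) - grad f x0) . w dv]
    is at most [L v |w|^2]. *)
Lemma taylor1_le f x0 w r L : 0 < r ->
  twice_differentiable_on (eball x0 r) f -> lipschitz_grad (eball x0 r) f L ->
  enorm w <= r -> f @ within (eball x0 r) (nbhs (x0 + w)) --> f (x0 + w) ->
  `|f (x0 + w) - f x0 - dot (grad f x0) w| <= L / 2 * enorm w ^+ 2.
Proof.
move=> r0 [df _] fL wr fw.
have ray (v : R) := @eball_ray R n x0 w r v r0.
pose h v := f (x0 + v *: w) - v * dot (grad f x0) w.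
pose dh v := dot (grad f (x0 + v *: w)) w - dot (grad f x0) w.
have := @normr_increment_le R h dh 0 (L * enorm w ^+ 2).
rewrite /h scale1r scale0r addr0 mul1r mul0r subr0 add0r => /(_ _ _ _)/le_trans.
rewrite addrAC; apply.
- move=> v v0 v1; have ? := is_derive_line (df _ (ray v v0 v1 wr)).
  by apply: is_derive_eq; rewrite /dh /GRing.scale /=; ring.
- apply: cvgB.
    exact: line_cvg_left (fun v v0 v1 => ray v v0 v1 wr) fw.
  exact: mulr_cvg_left1.
- move=> v v0 v1; rewrite add0r /dh -dotBl; apply: le_trans (normr_dot_le _ _) _.
  have xc : eball x0 r x0 by rewrite /eball /= subrr enorm0.
  have := fL _ _ (ray v v0 v1 wr) xc.
  rewrite addrDKl enormZ (ger0_norm v0) => /(ler_wpM2r (enorm_ge0 w)).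
  move=> /le_trans; apply; lra.
- lra.
Qed.

(** Keeping the reference point [z] apart from [a] gives an estimate at all points
    [a = x0 + v t] of a segment with one and the same Hessian, ready to be
    integrated in [v]. *)
Lemma grad_increment_le f (B : set 'cV[R]_n) z a s t L : 0 <= L ->
  twice_differentiable_on B f -> lipschitz_hess B f L -> B z ->
  (forall u, 0 <= u <= 1 -> B (a + u *: s)) ->
  `|dot (grad f (a + s)) t - dot (grad f a) t - dot s (hess f z *m t)| <=
  L * enorm s * enorm t * (enorm (a - z) + enorm s / 2).
Proof.
move=> L0 [_ df] fL Bz Bs.
have d (u : R) : 0 <= u <= 1 ->
    is_derive u 1 (fun u => dot (grad f (a + u *: s)) t)
    (dot s (hess f (a + u *: s) *m t)).
  by move=> u01; apply: is_derive_grad_line => j; apply/df/Bs.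
pose h u := dot (grad f (a + u *: s)) t - u * dot s (hess f z *m t).
pose dh u := dot s (hess f (a + u *: s) *m t) - dot s (hess f z *m t).
have := @normr_increment_le R h dh (L * enorm s * enorm t * enorm (a - z))
  (L * enorm s * enorm t * enorm s).
rewrite /h scale1r scale0r addr0 mul1r mul0r subr0 => /(_ _ _ _)/le_trans.
rewrite addrAC; apply.
- move=> u u0 u1; have /d du : 0 <= u <= 1 by rewrite u0 ltW.
  exact: is_deriveB du (is_derive_mulr_cst _ _).
- apply: cvgB; [apply: cvg_at_left_filter|exact: mulr_cvg_left1].
  rewrite -[X in _ --> dot (grad f (a + X)) t]scale1r.
  by apply: (is_derive_continuous (d 1 _)); rewrite ler01 lexx.
- move=> u u0 u1; rewrite /dh -dotBr -mulmxBl.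
  apply: le_trans (normr_dot_mulmx _ _ _) _.
  have Bu : B (a + u *: s) by apply: Bs; rewrite u0 ltW.
  have := fL _ _ Bu Bz => /(ler_wpM2r (mulr_ge0 (enorm_ge0 s) (enorm_ge0 t))).
  move=> /le_trans; apply.
  have : enorm (a + u *: s - z) <= enorm (a - z) + u * enorm s.
    rewrite addrAC; apply: le_trans (enormD _ _) _.
    by rewrite enormZ (ger0_norm u0).
  move=> /(ler_wpM2l (mulr_ge0 L0 (mulr_ge0 (enorm_ge0 s) (enorm_ge0 t)))); lra.
- lra.
Qed.

(** The second difference is the increment over [v] in [[0, 1]] of
    [f (x0 + s + v t) - f (x0 + v t)], whose derivative is a gradient increment. *)
Lemma second_difference_le f x0 s t r L : 0 < r -> 0 <= L ->
  twice_differentiable_on (eball x0 r) f -> lipschitz_hess (eball x0 r) f L ->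
  enorm s + enorm t <= r -> enorm s < r -> enorm t < r ->
  f @ within (eball x0 r) (nbhs (x0 + s + t)) --> f (x0 + s + t) ->
  `|f (x0 + s + t) - f (x0 + s) - (f (x0 + t) - f x0) - dot s (hess f x0 *m t)|
  <= L * enorm s * enorm t * (enorm s + enorm t) / 2.
Proof.
move=> r0 L0 df fL st_r sr tr fst.
have xc : eball x0 r x0 by rewrite /eball /= subrr enorm0.
have xt : eball x0 r (x0 + t) by rewrite /eball /= addrDKl.
have xs : eball x0 r (x0 + s) by rewrite /eball /= addrDKl.
have Bt (v : R) : 0 <= v -> v <= 1 -> eball x0 r (x0 + v *: t).
  by move=> v0 v1; apply: eball_segment; rewrite ?v0.
have Bst (v : R) : 0 <= v -> v < 1 -> eball x0 r (x0 + s + v *: t).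
  move=> v0 v1; rewrite /eball /= -[x0 + s + _]addrA addrDKl.
  apply: le_lt_trans (enormD _ _) _; rewrite enormZ ger0_norm //.
  have [t0|t0] := eqVneq (enorm t) 0; first by rewrite t0 mulr0 addr0.
  apply: lt_le_trans st_r; rewrite ltrD2l gtr_pMl // lt_neqAle eq_sym t0.
  exact: enorm_ge0.
pose H := dot s (hess f x0 *m t).
pose h v := f (x0 + s + v *: t) - f (x0 + v *: t) - v * H.
pose dh v := dot (grad f (x0 + s + v *: t)) t - dot (grad f (x0 + v *: t)) t - H.
have := @normr_increment_le R h dh (L * enorm s * enorm t * (enorm s / 2))
  (L * enorm s * enorm t * enorm t).
rewrite /h !scale1r !scale0r !addr0 mul1r mul0r subr0 => /(_ _ _ _)/le_trans hl.
have -> : f (x0 + s + t) - f (x0 + s) - (f (x0 + t) - f x0) - H =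
  f (x0 + s + t) - f (x0 + t) - H - (f (x0 + s) - f x0) by ring.
apply: hl.
- move=> v v0 v1; have ? := is_derive_line (df.1 _ (Bst v v0 v1)).
  have ? := is_derive_line (df.1 _ (Bt v v0 (ltW v1))).
  by apply: is_derive_eq; rewrite /dh /GRing.scale /=; ring.
- apply: cvgB; last exact: mulr_cvg_left1.
  apply: cvgB; first exact: line_cvg_left Bst fst.
  apply: (line_cvg_left (fun v v0 v1 => Bt v v0 (ltW v1))).
  exact/within_continuous/df.1.
- move=> v v0 v1.
  have addst : x0 + s + v *: t = x0 + v *: t + s by rewrite addrAC.
  rewrite /dh addst.
  have := @grad_increment_le f (eball x0 r) x0 (x0 + v *: t) s t L L0 df fL xc.
  rewrite addrDKl enormZ (ger0_norm v0) => /(_ _)/le_trans.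
  apply; last lra.
  move=> u /andP[u0 u1]; apply: eball_segment; rewrite ?u0 //; first exact: Bt (ltW v1).
  by rewrite -addst; exact: Bst.
- lra.
Qed.

(** The integrand is at most [L |w|^3 v^2 / 2], which gives the sharp constant
    [1 / 6]; bounding it by [L |w|^3 v / 2] gives [1 / 4], precise enough for the
    gradient of the interpolant. *)
Lemma taylor2_le f x0 w r L : 0 < r -> 0 <= L ->
  twice_differentiable_on (eball x0 r) f -> lipschitz_hess (eball x0 r) f L ->
  enorm w <= r -> f @ within (eball x0 r) (nbhs (x0 + w)) --> f (x0 + w) ->
  `|f (x0 + w) - f x0 - dot (grad f x0) w - dot w (hess f x0 *m w) / 2|
  <= L * enorm w ^+ 3 / 4.
Proof.
move=> r0 L0 df fL wr fw.
have xc : eball x0 r x0 by rewrite /eball /= subrr enorm0.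
have ray (v : R) := @eball_ray R n x0 w r v r0.
pose H := dot w (hess f x0 *m w).
pose h v := f (x0 + v *: w) - v * dot (grad f x0) w - H / 2 * v ^+ 2.
pose dh v := dot (grad f (x0 + v *: w)) w - dot (grad f x0) w - v * H.
have := @normr_increment_le R h dh 0 (L * enorm w ^+ 3 / 2).
rewrite /h scale1r scale0r addr0 mul1r mul0r !subr0 add0r => /(_ _ _ _)/le_trans hl.
have -> : f (x0 + w) - f x0 - dot (grad f x0) w - H / 2 =
  f (x0 + w) - dot (grad f x0) w - H / 2 * 1 ^+ 2 - (f x0 - H / 2 * 0 ^+ 2) by ring.
apply: hl.
- move=> v v0 v1; have ? := is_derive_line (df.1 _ (ray v v0 v1 wr)).
  by apply: is_derive_eq; rewrite /dh /GRing.scale /=; field.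
- apply: cvgB.
    apply: cvgB.
      exact: line_cvg_left (fun v v0 v1 => ray v v0 v1 wr) fw.
    exact: mulr_cvg_left1.
  by apply: cvg_at_left_filter; apply: cvgMl_tmp; exact: exprn_continuous.
- move=> v v0 v1; rewrite add0r /dh.
  have := @grad_increment_le f (eball x0 r) x0 x0 (v *: w) w L L0 df fL xc.
  rewrite subrr enorm0 add0r enormZ (ger0_norm v0) dotZl => /(_ _)/le_trans.
  apply; last first.
    have : v ^+ 2 <= v by rewrite expr2 ler_piMl // ltW.
    move=> /(ler_wpM2l (mulr_ge0 L0 (exprn_ge0 3 (enorm_ge0 w)))); lra.
  move=> u /andP[u0 u1]; rewrite scalerA; apply: ray => //; first exact: mulr_ge0.
  by apply: le_lt_trans v1; rewrite ler_piMl.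
- lra.
Qed.

End Increments.

(** * Errors of the simplex gradient and of the nested-set Hessian *)

Section Simplex.
Context {R : realType} (n m k : nat).
Implicit Types (f : 'cV[R]_n -> R) (T : 'M[R]_(n, k)) (S : 'M[R]_(n, m)).

(** [grad f x0] is the image of [T^T grad f x0] under the pseudoinverse, a left inverse
    of [T^T]; the difference is the image of the first order Taylor remainders,
    at most [L |t|^2 / 2] each. *)
Lemma simplex_grad_error f x0 T r L : (0 < n)%N -> 0 < r -> 0 <= L ->
  twice_differentiable_on (eball x0 r) f -> lipschitz_grad (eball x0 r) f L ->
  row_free T -> col_radius T < r ->
  enorm (simplex_grad f x0 T - grad f x0) <= E_simplex_grad L T * col_radius T.
Proof.
move=> n0 r0 L0 df fL Tfree Tr; have T0 := col_radius_gt0 n0 Tfree.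
pose d := \col_(j < k) (f (x0 + col j T) - f x0) - T^T *m grad f x0.
have -> : simplex_grad f x0 T - grad f x0 = mpinv T^T *m d.
  by rewrite mulmxBr mulmxA mpinv_tr_mulmx // mul1mx.
have dle : enorm d <= Num.sqrt k%:R * (L / 2 * col_radius T ^+ 2).
  apply: enorm_le_coord => [|j]; first by rewrite mulr_ge0 ?sqr_ge0 // divr_ge0.
  have -> : d j 0 = f (x0 + col j T) - f x0 - dot (grad f x0) (col j T).
    rewrite !mxE; congr (_ - _); apply: eq_bigr => i _.
    by rewrite !mxE mulrC.
  have tr : enorm (col j T) < r by apply: le_lt_trans (enorm_col_le _ _) Tr.
  apply: le_trans (taylor1_le r0 df fL (ltW tr) _) _.
    by apply/within_continuous/df.1; rewrite /eball /= addrDKl.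
  rewrite ler_wpM2l ?divr_ge0 // ler_pXn2r ?nnegrE ?enorm_ge0 ?(ltW T0) //.
  exact: enorm_col_le.
apply: le_trans (enorm_mulmx _ _) _.
apply: le_trans (ler_pM (opnorm_ge0 _) (enorm_ge0 _) (opnorm_mpinv_tr n0 Tfree) dle) _.
rewrite /E_simplex_grad le_eqVlt; apply/orP; left; apply/eqP; field.
by rewrite gt_eqF.
Qed.

(** A row of [delta - S^T hess f x0] is the pseudoinverse of [T^T] applied to
    second differences from which the bilinear form of the Hessian has been
    subtracted. *)
Lemma nested_hess_error f x0 S T r L : (0 < n)%N -> 0 < r -> 0 <= L ->
  twice_differentiable_on (eball x0 r) f -> lipschitz_hess (eball x0 r) f L ->
  row_free S -> row_free T -> col_radius S + col_radius T <= r ->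
  (forall i j, f @ within (eball x0 r) (nbhs (x0 + col i S + col j T)) -->
    f (x0 + col i S + col j T)) ->
  opnorm (nested_hess f x0 S T - hess f x0) <= E_nested_hess L S T * Delta_u S T.
Proof.
move=> n0 r0 L0 df fL Sfree Tfree STr fST.
have S0 := col_radius_gt0 n0 Sfree; have T0 := col_radius_gt0 n0 Tfree.
set dS := col_radius S in S0 STr *; set dT := col_radius T in T0 STr *.
have [S0' T0'] := (ltW S0, ltW T0).
pose rho := opnorm (mpinv T^T) * (Num.sqrt k%:R * (L * dS * dT * (dS + dT) / 2)).
have rho0 : 0 <= L * dS * dT * (dS + dT) / 2.
  by rewrite divr_ge0 ?mulr_ge0 ?addr_ge0.
pose N := \matrix_(i < m, j < n)
  (simplex_grad f (x0 + col i S) T - simplex_grad f x0 T) j 0 - S^T *m hess f x0.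
have -> : nested_hess f x0 S T - hess f x0 = mpinv S^T *m N.
  by rewrite mulmxBr mulmxA mpinv_tr_mulmx // mul1mx.
have Nle : opnorm N <= Num.sqrt m%:R * rho.
  apply: opnorm_le_row => [|i]; first by rewrite mulr_ge0 ?opnorm_ge0 // mulr_ge0 ?sqrtr_ge0.
  pose d := \col_(j < k) (f (x0 + col i S + col j T) - f (x0 + col i S) -
    (f (x0 + col j T) - f x0) - dot (col i S) (hess f x0 *m col j T)).
  have -> : (row i N)^T = mpinv T^T *m d.
    have -> : d = \col_(j < k) (f (x0 + col i S + col j T) - f (x0 + col i S))
        - \col_(j < k) (f (x0 + col j T) - f x0) - T^T *m ((hess f x0)^T *m col i S).
      apply/colP => j; rewrite !mxE; congr (_ - _).
      rewrite -(trmxK (hess f x0)) -dot_mulmx dotC trmxK.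
      by apply: eq_bigr => a _; rewrite [T^T _ _]mxE [in LHS]mxE.
    rewrite mulmxBr (mulmxA _ T^T) mpinv_tr_mulmx // mul1mx mulmxBr.
    apply/colP => j; rewrite [LHS]mxE [LHS]mxE [LHS]mxE [RHS]mxE; congr (_ + _).
      by rewrite mxE.
    rewrite [LHS]mxE [RHS]mxE; congr (- _); rewrite !mxE; apply: eq_bigr => a _.
    by rewrite !mxE mulrC.
  apply: le_trans (enorm_mulmx _ _) _; rewrite ler_wpM2l ?opnorm_ge0 //.
  apply: enorm_le_coord => // j; rewrite mxE.
  have si : enorm (col i S) <= dS := enorm_col_le _ _.
  have tj : enorm (col j T) <= dT := enorm_col_le _ _.
  apply: le_trans (second_difference_le r0 L0 df fL _ _ _ (fST i j)) _.
  - by apply: le_trans (lerD si tj) _.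
  - lra.
  - lra.
  - rewrite ler_pM2r ?invr_gt0 // ler_pM ?mulr_ge0 ?addr_ge0 ?enorm_ge0 //.
      by rewrite ler_pM ?mulr_ge0 ?enorm_ge0 // ler_wpM2l.
    exact: lerD.
apply: le_trans (opnormM _ _) _.
apply: le_trans (ler_pM (opnorm_ge0 _) (opnorm_ge0 _) (opnorm_mpinv_tr n0 Sfree) Nle) _.
rewrite /E_nested_hess (opnorm_mpinv_normalized n0 Tfree).
set a := opnorm (mpinv (normalized S)^T); set b := opnorm (mpinv (normalized T)^T).
have b_le : opnorm (mpinv T^T) <= b / dT := opnorm_mpinv_tr n0 Tfree.
have a0 : 0 <= a := opnorm_ge0 _; have b0 : 0 <= b := opnorm_ge0 _.
have m1 : 1 <= m%:R :> R.
  by rewrite ler1n (leq_trans n0) // -(eqP Sfree) rank_leq_col.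
have sqrtm : Num.sqrt m%:R <= m%:R :> R.
  rewrite -[leRHS]ger0_norm // -sqrtr_sqr; apply: ler_wsqrtr.
  by rewrite expr2 ler_peMl.
set u := Delta_u S T.
have u0 : 0 < u by rewrite lt_max S0.
have l0 : 0 < Delta_l S T by rewrite lt_min S0 T0.
have ul : 1 <= u / Delta_l S T.
  by rewrite ler_pdivlMr // mul1r ge_min /u /Delta_u !le_max lexx.
have Su : dS <= u by rewrite le_max lexx.
have Tu : dT <= u by rewrite le_max lexx orbT.
set c := L * a * b * Num.sqrt k%:R.
have c0 : 0 <= c by rewrite !mulr_ge0 ?sqrtr_ge0.
(* After [sqrt m <= m] the factors [dS] and [dT] cancel; what is left is
   [(dS + dT) / 2 <= u], while [2 u / Delta_l + 3 >= 5] absorbs the factor [1 / 3]. *)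
apply: (@le_trans _ _ (c * m%:R * u)).
  apply: (@le_trans _ _ (a / dS * (m%:R * (b / dT * (Num.sqrt k%:R *
    (L * dS * dT * (dS + dT) / 2)))))).
    rewrite ler_wpM2l ?divr_ge0 // ler_pM ?sqrtr_ge0 //.
      by rewrite mulr_ge0 ?opnorm_ge0 // mulr_ge0 ?sqrtr_ge0.
    by rewrite ler_wpM2r // mulr_ge0 ?sqrtr_ge0.
  have -> : a / dS * (m%:R * (b / dT * (Num.sqrt k%:R *
      (L * dS * dT * (dS + dT) / 2)))) = c * m%:R * ((dS + dT) / 2).
    by rewrite /c; field; rewrite !gt_eqF.
  by rewrite ler_wpM2l ?mulr_ge0 //; lra.
have -> : m%:R * Num.sqrt k%:R / 3 * L * (2 * (u / Delta_l S T) + 3) * a * b * u =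
    c * m%:R * u * ((2 * (u / Delta_l S T) + 3) / 3) by rewrite /c; ring.
rewrite ler_peMr ?mulr_ge0 ?(ltW u0) //; lra.
Qed.

End Simplex.

(** * Hessian of a power *)

Section Power.
Context {R : realType} (n : nat).

Lemma partial_pow (f : 'cV[R]_n -> R) p j x : differentiable f x ->
  partial j (fun y => f y ^+ p) x = p%:R * f x ^+ p.-1 * partial j f x.
Proof.
move=> fx; have -> : (fun y => f y ^+ p) = f ^+ p by apply/funext => y; rewrite exprfctE.
by rewrite /partial deriveX //; exact: diff_derivable.
Qed.

Lemma hess_pow (f : 'cV[R]_n -> R) x0 r p : 0 < r -> (2 <= p)%N ->
  twice_differentiable_on (eball x0 r) f ->
  hess (fun x => f x ^+ p) x0 =
  (p%:R * f x0 ^+ (p - 1)) *: hess f x0 +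
  ((p * (p - 1))%:R * f x0 ^+ (p - 2)) *: (grad f x0 *m (grad f x0)^T).
Proof.
move=> r0 p2 [df ddf].
have xc : eball x0 r x0 by rewrite /eball /= subrr enorm0.
apply/matrixP => i j; rewrite !mxE big_ord1 !mxE.
(* The inner derivative is only known on the ball, so it is replaced near [x0]. *)
have -> : partial i (partial j (fun x => f x ^+ p)) x0 =
    partial i (f ^+ p.-1 * (p%:R *: partial j f)) x0.
  apply: near_eq_derive; near=> y.
  rewrite partial_pow; last by apply: df; near: y; exact: eball_open.
  transitivity (f y ^+ p.-1 * (p%:R * partial j f y)); first by ring.
  by rewrite [RHS]/= exprfctE.
have := derivableP (diff_derivable (v := delta_mx i 0) (df _ xc)) => dfx.
have := derivableP (diff_derivable (v := delta_mx i 0) (ddf j _ xc)) => ddfx.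
rewrite /partial derive_val exprfctE /= subn1 subn2 natrM.
rewrite -[(p%:R *: _) x0]/(p%:R * 'D_(delta_mx j 0) f x0).
by rewrite /GRing.scale /=; ring.
Unshelve. all: by end_near. Qed.

End Power.

(** * Quadratic functions as vectors of coefficients *)

Section QuadraticModel.
Context {R : realType} (n : nat).

(** The three summands stand for the monomials [z_a], [z_a ^ 2 / 2] and [z_a z_b]. *)
Definition monomial_index : Type := ('I_n + 'I_n + 'I_n * 'I_n)%type.

(** The order is that of the entries of [quad_row]. *)
Definition monomials : seq monomial_index :=
  [seq inl (inl a) | a <- enum 'I_n] ++ [seq inl (inr a) | a <- enum 'I_n] ++
  [seq inr ab | ab : 'I_n * 'I_n <- enum {: 'I_n * 'I_n} & (ab.1 < ab.2)%N].

Definition monomial_eval (z : 'cV[R]_n) (i : monomial_index) : R :=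
  match i with
  | inl (inl a) => z a 0
  | inl (inr a) => 2^-1 * z a 0 ^+ 2
  | inr ab => z ab.1 0 * z ab.2 0
  end.

(** The coefficient of a monomial in [g . z + z . H z / 2], for an arbitrary square
    matrix [H]: off the diagonal its two halves are averaged. *)
Definition monomial_coef (g : 'cV[R]_n) (H : 'M[R]_n) (i : monomial_index) : R :=
  match i with
  | inl (inl a) => g a 0
  | inl (inr a) => H a a
  | inr ab => (H ab.1 ab.2 + H ab.2 ab.1) / 2
  end.

Lemma quad_rowE (z : 'cV[R]_n) : quad_row z = map (monomial_eval z) monomials.
Proof. by rewrite /quad_row /monomials !map_cat -!map_comp. Qed.

Lemma size_monomials : size monomials = quad_size n.
Proof.
have pairs : size [seq ab : 'I_n * 'I_n <- enum {: 'I_n * 'I_n} | (ab.1 < ab.2)%N]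
    = 'C(n, 2).
  rewrite size_filter -sum1_count big_enum_cond /=.
  rewrite (eq_bigl (fun ab : 'I_n * 'I_n => xpredT ab.1 && (ab.1 < ab.2)%N)) //.
  rewrite -(pair_big_dep xpredT (fun i j : 'I_n => (i < j)%N) (fun _ _ => 1%N)) /=.
  rewrite (exchange_big_dep xpredT) //= -bin2_sum big_mkord.
  apply: eq_bigr => j _.
  by rewrite -(big_ord_widen _ (fun=> 1%N) (ltnW (ltn_ord j))) sum1_card card_ord.
rewrite !size_cat !size_map pairs.
rewrite -enumT size_enum_ord /quad_size mulnC divn2.
by rewrite -[(n.+2 * _)%N]/(n.+2 * n.+2.-1)%N -bin2 !binS bin1 bin0; lia.
Qed.

Lemma monomials_uniq : uniq monomials.
Proof.
have inlU (h : 'I_n -> 'I_n + 'I_n) : injective h ->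
    uniq [seq inl (h a) : monomial_index | a <- enum 'I_n].
  by move=> hi; rewrite map_inj_uniq ?enum_uniq // => ? ? [] /hi.
have inrU : uniq [seq inr ab : monomial_index |
    ab : 'I_n * 'I_n <- enum {: 'I_n * 'I_n} & (ab.1 < ab.2)%N].
  by rewrite map_inj_uniq ?filter_uniq -?enumT ?enum_uniq // => ? ? [].
rewrite cat_uniq cat_uniq inrU !inlU ?andbT /=; try by move=> ? ? [].
apply/andP; split; apply/hasPn => i.
  by rewrite mem_cat => /orP[]/mapP[a _ ->]; apply/negP => /mapP[].
by move=> /mapP[a _ ->]; apply/negP => /mapP[].
Qed.

Definition monomial_tuple : (quad_size n).-tuple monomial_index :=
  Tuple (introT eqP size_monomials).

Lemma sum_monomials (F : monomial_index -> R) :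
  \sum_(j < quad_size n) F (tnth monomial_tuple j) =
  \sum_a F (inl (inl a)) + (\sum_a F (inl (inr a)) +
  \sum_(ab : 'I_n * 'I_n | (ab.1 < ab.2)%N) F (inr ab)).
Proof.
rewrite -(big_tuple _ _ monomial_tuple xpredT F) /= !big_cat; congr (_ + (_ + _)).
- by rewrite big_map big_enum.
- by rewrite big_map big_enum.
- by rewrite big_map big_filter big_enum_cond.
Qed.

(** The terms below and above the diagonal of the double sum [z . H z] are
    paired up by exchanging the two indices. *)
Lemma sum_monomial_coef g H (z : 'cV[R]_n) :
  \sum_(j < quad_size n) monomial_eval z (tnth monomial_tuple j) *
    monomial_coef g H (tnth monomial_tuple j) = dot g z + dot z (H *m z) / 2.
Proof.
rewrite (sum_monomials (fun i => monomial_eval z i * monomial_coef g H i)) /=.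
congr (_ + _); first by apply: eq_bigr => a _; rewrite mulrC.
pose F (ab : 'I_n * 'I_n) := z ab.1 0 * H ab.1 ab.2 * z ab.2 0.
have -> : dot z (H *m z) = \sum_ab F ab.
  rewrite -(pair_big xpredT xpredT (fun a b => z a 0 * H a b * z b 0)) /=.
  apply: eq_bigr => a _; rewrite mxE mulr_sumr; apply: eq_bigr => b _.
  by rewrite mulrA.
rewrite [X in _ = X / 2](bigID (fun ab : 'I_n * 'I_n => ab.1 == ab.2)) /= mulrDl.
congr (_ + _).
  rewrite [X in _ = X / 2](reindex_onto (fun a : 'I_n => (a, a)) fst) /=; last first.
    by move=> [a b] /= /eqP ->.
  rewrite mulr_suml; apply: eq_big => [a|a _]; first by rewrite !eqxx.
  by rewrite /F /=; ring.
rewrite [X in _ = X / 2](bigID (fun ab : 'I_n * 'I_n => (ab.1 < ab.2)%N)) /=.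
have lt_ne : forall ab : 'I_n * 'I_n,
    (ab.1 != ab.2) && (ab.1 < ab.2)%N = (ab.1 < ab.2)%N.
  by move=> [a b] /=; case: ltngtP => //; rewrite ?andbT ?andbF // -val_eqE /=; case: ltngtP.
rewrite (eq_bigl _ _ lt_ne) [X in _ = (_ + X) / 2](reindex_onto (fun ab => (ab.2, ab.1))
  (fun ab => (ab.2, ab.1))) /=; last by move=> [].
rewrite [X in _ = (_ + X) / 2](eq_bigl (fun ab : 'I_n * 'I_n => (ab.1 < ab.2)%N)); last first.
  by move=> [a b] /=; rewrite eqxx andbT -val_eqE /=; case: ltngtP.
rewrite -big_split mulr_suml; apply: eq_bigr => -[a b] _.
by rewrite /F /=; ring.
Qed.

(** Every vector of coefficients comes from a quadratic function: the entries of [v]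
    are read off at the position of each monomial and [H] is filled symmetrically. *)
Lemma monomial_coef_surj (v : 'cV[R]_(quad_size n)) : exists g H,
  H^T = H /\ v = \col_j monomial_coef g H (tnth monomial_tuple j).
Proof.
pose w (i : monomial_index) :=
  if [pick j | tnth monomial_tuple j == i] is Some j then v j 0 else 0.
have wE j : w (tnth monomial_tuple j) = v j 0.
  rewrite /w; case: pickP => [j' /eqP|/(_ j)]; last by rewrite eqxx.
  have /tuple_uniqP inj : uniq monomial_tuple := monomials_uniq.
  by move/inj ->.
pose H := \matrix_(a, b) (if a == b then w (inl (inr a)) else
  if (a < b)%N then w (inr (a, b)) else w (inr (b, a))).
exists (\col_a w (inl (inl a))), H; split.
  apply/matrixP => a b; rewrite !mxE eq_sym; case: eqVneq => [->//|].
  by rewrite -val_eqE /=; case: ltngtP.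
apply/colP => j; rewrite mxE -wE.
have := mem_tnth j monomial_tuple; rewrite /= !mem_cat.
move=> /or3P[]/mapP[a ain ->] /=; rewrite ?mxE ?eqxx //.
case: a ain => a b; rewrite mem_filter /= => /andP[ab _].
rewrite /= eq_sym ab; case: eqVneq ab => [->|_ ab]; first by rewrite ltnn.
by rewrite ltnNge (ltnW ab) /=; field.
Qed.

(** The first [n] coefficients are the entries of [g]. *)
Lemma enorm_le_monomial_coef (g : 'cV[R]_n) H :
  enorm g <= enorm (\col_j monomial_coef g H (tnth monomial_tuple j)).
Proof.
rewrite enorm_le_sqr ?enorm_ge0 // enorm_sqr /dot.
under [leRHS]eq_bigr => j _ do rewrite !mxE -expr2.
rewrite (sum_monomials (fun i => monomial_coef g H i ^+ 2)) /=.
under eq_bigr => j _ do rewrite -expr2.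
rewrite lerDl addr_ge0 // sumr_ge0 // => *; exact: sqr_ge0.
Qed.

Lemma quadratic_shift c (x w : 'cV[R]_n) : c.2^T = c.2 ->
  quadratic c (x + w) =
  quadratic c x + dot (c.1.2 + c.2 *m x) w + dot w (c.2 *m w) / 2.
Proof.
case: c => -[a0 a] H /= Hs; rewrite /quadratic /= -!mulmxA !dotE.
rewrite mulmxDr !dotDr !dotDl (dotC w (H *m x)) [dot (H *m x) w]dot_mulmx Hs.
by field.
Qed.

(** The coefficients of [a0 + g . (z - x) + (z - x) . H (z - x) / 2] as a function
    of [z]. *)
Definition quadratic_at (x : 'cV[R]_n) a0 (g : 'cV[R]_n) (H : 'M[R]_n) :
    R * 'cV[R]_n * 'M[R]_n :=
  (a0 - dot (g - H *m x) x - dot x (H *m x) / 2, g - H *m x, H).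

Lemma quadratic_atE x a0 g H w : H^T = H ->
  quadratic (quadratic_at x a0 g H) (x + w) = a0 + dot g w + dot w (H *m w) / 2.
Proof.
move=> Hs; rewrite quadratic_shift //= subrK; congr (_ + _ + _).
by rewrite /quadratic /= -mulmxA !dotE; field.
Qed.

Lemma grad_quadratic c (x : 'cV[R]_n) : c.2^T = c.2 ->
  grad (quadratic c) x = c.1.2 + c.2 *m x.
Proof.
move=> Hs; apply/colP => i; rewrite mxE /partial.
set e := delta_mx i 0; set g := c.1.2 + c.2 *m x.
have := (derive_lineE (quadratic c) x e 0).2; rewrite scale0r addr0 => <-.
have -> : (fun u : R => quadratic c (x + u *: e)) =
    (fun u : R => quadratic c x + u * dot g e + (dot e (c.2 *m e) / 2) * u ^+ 2).
  apply/funext => u; rewrite quadratic_shift // -scalemxAr !dotZr dotZl; ring.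
rewrite derive_val /GRing.scale /=.
have -> : dot g e = g i 0.
  rewrite /dot (bigD1 i) //= big1 => [|j /negbTE ji].
    by rewrite [e i 0]mxE !eqxx mulr1 addr0.
  by rewrite [e j 0]mxE ji mulr0.
ring.
Qed.

End QuadraticModel.

(** * Gradient of the quadratic interpolant *)

Section Interpolation.
Context {R : realType} (n m k : nat) (S : 'M[R]_(n, m)) (T : 'M[R]_(n, k))
  (x0 : 'cV[R]_n) (y : 'I_(quad_size n).+1 -> 'cV[R]_n).

Let D := col_radius S + col_radius T.

(** [Qhat] uses points scaled by [1 / D], so the first and second order parts pick up
    the factors [1 / D] and [1 / D ^ 2]. *)
Lemma Qhat_mulmx g H i : y ord0 = x0 -> D != 0 ->
  (Qhat S T y *m \col_j monomial_coef g H (tnth (monomial_tuple n) j)) i 0 =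
  D^-1 * dot g (y (lift ord0 i) - x0) +
  D^-2 * (dot (y (lift ord0 i) - x0) (H *m (y (lift ord0 i) - x0)) / 2).
Proof.
move=> y0 D0; rewrite mxE.
set w := y (lift ord0 i) - x0.
transitivity (dot g (D^-1 *: w) + dot (D^-1 *: w) (H *m (D^-1 *: w)) / 2).
  rewrite -sum_monomial_coef; apply: eq_bigr => j _; rewrite !mxE y0 quad_rowE.
  set d := tnth _ j.
  have dE : d = nth d (monomials n) j := tnth_nth d (monomial_tuple n) j.
  by rewrite (nth_map d) ?size_monomials // -dE.
by rewrite -scalemxAr !dotZr dotZl; field.
Qed.

Lemma Qhat_quadratic_at a0 g H i : y ord0 = x0 -> D != 0 -> H^T = H ->
  quadratic (quadratic_at x0 a0 (D^-1 *: g) (D^-2 *: H)) (y (lift ord0 i)) =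
  a0 + (Qhat S T y *m \col_j monomial_coef g H (tnth (monomial_tuple n) j)) i 0.
Proof.
move=> y0 D0 Hs; rewrite Qhat_mulmx //; set w := y _ - x0.
have -> : y (lift ord0 i) = x0 + w by rewrite addrC subrK.
rewrite quadratic_atE; last by rewrite linearZ /= Hs.
by rewrite dotZl -scalemxAl dotZr; ring.
Qed.

Lemma quadratic_at_center a0 g H : H^T = H ->
  quadratic (quadratic_at x0 a0 g H) x0 = a0.
Proof.
by move=> Hs; rewrite -{2}[x0]addr0 quadratic_atE // mulmx0 -(scale0r 0) !dotZr; ring.
Qed.

(** A vector of the kernel is the list of coefficients of a quadratic function
    that vanishes at all sample points. *)
Lemma poised_Qhat_unitmx : poised (sample_set x0 S T) -> D != 0 ->
  y ord0 = x0 -> range y = sample_set x0 S T -> Qhat S T y \in unitmx.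
Proof.
move=> [_ [c0 [_ c0uniq]]] D0 y0 yS.
have kerQ (v : 'cV[R]_(quad_size n)) : Qhat S T y *m v = 0 -> v = 0.
  have [g [H [Hs ->]]] := monomial_coef_surj v => Qv.
  set c := quadratic_at x0 0 (D^-1 *: g) (D^-2 *: H).
  have H's : (D^-2 *: H)^T = D^-2 *: H by rewrite linearZ /= Hs.
  have c_zero x : sample_set x0 S T x -> quadratic c x = 0.
    rewrite -yS => -[i _ <-]; case: (unliftP ord0 i) => [j|] ->.
      by rewrite Qhat_quadratic_at // Qv mxE addr0.
    by rewrite y0 quadratic_at_center.
  have zero_sol : c0 = (0, 0, 0).
    apply: c0uniq; split; first by rewrite trmx0.
    by move=> x _; rewrite /quadratic /= trmx0 mul0mx mulmx0 mul0mx !mxE; ring.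
  have := c0uniq c (conj H's c_zero); rewrite zero_sol => -[_ g0 H0'].
  have H0 : H = 0.
    by rewrite -[H](scalerK (invr_neq0 (expf_neq0 2 D0))) -H0' scaler0.
  have {}g0 : g = 0.
    rewrite -[g](scalerK (invr_neq0 D0)).
    by rewrite -[D^-1 *: g](subrK (D^-2 *: H *m x0)) -g0 -H0' mul0mx addr0 scaler0.
  apply/colP => j; rewrite g0 H0 !mxE.
  by case: (tnth _ j) => [[a|a]|ab] /=; rewrite !mxE ?addr0 ?mul0r.
rewrite -unitmx_tr -row_free_unit -kermx_eq0; apply/eqP/row_matrixP => i.
rewrite row0; apply: trmx_inj; rewrite trmx0; apply: kerQ.
by apply: trmx_inj; rewrite trmx_mul trmxK -row_mul mulmx_ker row0 trmx0.
Qed.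

Lemma quad_interp_exists (f : 'cV[R]_n -> R) : D != 0 -> y ord0 = x0 ->
  range y = sample_set x0 S T -> Qhat S T y \in unitmx ->
  exists c, [/\ c.2^T = c.2, quad_interp f (sample_set x0 S T) = quadratic c &
    forall i, quadratic c (y i) = f (y i)].
Proof.
move=> D0 y0 yS Qu.
pose d := \col_i (f (y (lift ord0 i)) - f x0).
have [g [H [Hs vE]]] := monomial_coef_surj (invmx (Qhat S T y) *m d).
set c := quadratic_at x0 (f x0) (D^-1 *: g) (D^-2 *: H).
have H's : (D^-2 *: H)^T = D^-2 *: H by rewrite linearZ /= Hs.
have cy i : quadratic c (y i) = f (y i).
  case: (unliftP ord0 i) => [j|] ->; last by rewrite y0 quadratic_at_center.
  by rewrite Qhat_quadratic_at // -vE mulKVmx // mxE addrC subrK.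
pose P := [set Q : 'cV[R]_n -> R | (exists c : R * 'cV[R]_n * 'M[R]_n,
  c.2^T = c.2 /\ Q = quadratic c) /\ forall x, sample_set x0 S T x -> Q x = f x].
have Pc : P (quadratic c).
  by split; [exists c|move=> x; rewrite -yS => -[i _ <-]].
have [[c' [c's Qc']] Qf] : P (quad_interp f (sample_set x0 S T)) := xgetI _ Pc.
exists c'; split=> // i; rewrite -Qc'; apply: Qf; rewrite -yS; by exists i.
Qed.

(** The differences between the first and second order parts of the interpolant
    and of the Taylor polynomial at [x0] solve a linear system with matrix
    [Qhat] whose right-hand side consists of Taylor remainders. *)
Lemma grad_quad_error (f : 'cV[R]_n -> R) r L : 0 < r -> 0 <= L -> 0 < D -> D <= r ->
  twice_differentiable_on (eball x0 r) f -> lipschitz_hess (eball x0 r) f L ->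
  (forall x, sample_set x0 S T x ->
    enorm (x - x0) <= D /\ f @ within (eball x0 r) (nbhs x) --> f x) ->
  poised (sample_set x0 S T) -> y ord0 = x0 -> range y = sample_set x0 S T ->
  enorm (grad_quad f x0 S T - grad f x0) <= E_grad_quad L S T y * Delta_u S T ^+ 2.
Proof.
move=> r0 L0 D0 Dr df fL Sf pS y0 yS.
have D_neq0 : D != 0 by rewrite gt_eqF.
have Qu := poised_Qhat_unitmx pS D_neq0 y0 yS.
have [c [cs Qc cy]] := quad_interp_exists f D_neq0 y0 yS Qu.
rewrite /grad_quad Qc grad_quadratic //; set g := c.1.2 + c.2 *m x0.
pose u := \col_j monomial_coef (D *: (g - grad f x0))
  (D ^+ 2 *: (c.2 - hess f x0)) (tnth (monomial_tuple n) j).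
have ule : enorm (Qhat S T y *m u) <= Num.sqrt (quad_size n)%:R * (L * D ^+ 3 / 4).
  apply: enorm_le_coord => [|i].
    by rewrite divr_ge0 // mulr_ge0 // exprn_ge0 // ltW.
  have [wD fw] : enorm (y (lift ord0 i) - x0) <= D /\
      f @ within (eball x0 r) (nbhs (y (lift ord0 i))) --> f (y (lift ord0 i)).
    by apply: Sf; rewrite -yS; exists (lift ord0 i).
  have [w yE] : exists w, y (lift ord0 i) = x0 + w.
    by exists (y (lift ord0 i) - x0); rewrite addrC subrK.
  rewrite yE addrDKl in wD fw; rewrite Qhat_mulmx // yE addrDKl.
  have := cy (lift ord0 i); rewrite yE quadratic_shift // -{1}y0 cy y0 -/g => fE.
  have -> : D^-1 * dot (D *: (g - grad f x0)) w +
      D^-2 * (dot w (D ^+ 2 *: (c.2 - hess f x0) *m w) / 2) =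
      f (x0 + w) - f x0 - dot (grad f x0) w - dot w (hess f x0 *m w) / 2.
    rewrite -fE dotZl dotBl -scalemxAl dotZr mulmxBl !dotBr.
    by field; exact: D_neq0.
  apply: le_trans (taylor2_le r0 L0 df fL (le_trans wD Dr) fw) _.
  by rewrite ler_pM2r // ler_wpM2l // ler_pXn2r ?nnegrE ?enorm_ge0 ?(ltW D0).
have gle : D * enorm (g - grad f x0) <=
    opnorm (invmx (Qhat S T y)) * (Num.sqrt (quad_size n)%:R * (L * D ^+ 3 / 4)).
  rewrite -{1}(ger0_norm (ltW D0)) -enormZ.
  apply: le_trans (enorm_le_monomial_coef _ (D ^+ 2 *: (c.2 - hess f x0))) _.
  rewrite -/u -[u in enorm u](mulKmx Qu); apply: le_trans (enorm_mulmx _ _) _.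
  by rewrite ler_wpM2l ?opnorm_ge0.
rewrite -(ler_pM2l D0); apply: le_trans gle _; rewrite /E_grad_quad.
set o := opnorm _; set q := Num.sqrt (quad_size n)%:R; set du := Delta_u S T.
have o0 : 0 <= o := opnorm_ge0 _; have q0 : 0 <= q := sqrtr_ge0 _.
(* [D <= 2 du] turns the constant [1 / 4] of the Taylor remainder into [1], below
   the factor [6 (1 + sqrt 2)]. *)
have Ddu : D <= 2 * du.
  have : col_radius S <= du by rewrite le_max lexx.
  have : col_radius T <= du by rewrite le_max lexx orbT.
  rewrite /D; lra.
have D2 : D ^+ 2 / 4 <= du ^+ 2.
  have : D ^+ 2 <= (2 * du) ^+ 2.
    by rewrite ler_pXn2r ?nnegrE ?(ltW D0) // (le_trans (ltW D0)).
  rewrite exprMn; lra.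
have X0 : 0 <= D * (o * q * L) by rewrite !mulr_ge0 // ltW.
apply: (@le_trans _ _ (D * (o * q * L) * du ^+ 2)).
  have := ler_wpM2l X0 D2; lra.
have s0 : 0 <= Num.sqrt 2 :> R := sqrtr_ge0 _.
have Y0 : 0 <= D * (o * q * L) * du ^+ 2 by rewrite mulr_ge0 ?sqr_ge0.
have := mulr_ge0 Y0 s0; lra.
Qed.

End Interpolation.

(** * Error of an approximate Hessian of a power *)

(** With [u] approximating [v = grad f x0], the outer product [v v^T] in the
    Hessian of the power is replaced by [u u^T]; and [|u| <= |u - v| + |v|]. *)
Lemma power_hess_error (R : realType) (n : nat) (f : 'cV[R]_n -> R) x0 r p
    (N : 'M[R]_n) (u : 'cV[R]_n) a e : 0 < r -> (2 <= p)%N ->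
  twice_differentiable_on (eball x0 r) f ->
  opnorm (N - hess f x0) <= a -> enorm (u - grad f x0) <= e ->
  opnorm ((p%:R * f x0 ^+ (p - 1)) *: N +
    ((p * (p - 1))%:R * f x0 ^+ (p - 2)) *: (u *m u^T) -
    hess (fun x => f x ^+ p) x0) <=
  p%:R * a * `|f x0 ^+ (p - 1)| + (p * (p - 1))%:R * e * `|f x0 ^+ (p - 2)| *
    Num.min (e + 2 * enorm (grad f x0)) (enorm u + enorm (grad f x0)).
Proof.
move=> r0 p2 df Na ue; rewrite (hess_pow r0 p2 df); set v := grad f x0 in ue *.
rewrite opprD addrACA -!scalerBr; apply: le_trans (opnormD _ _) _.
have e0 : 0 <= e := le_trans (enorm_ge0 _) ue.
have uv : enorm u <= e + enorm v.
  rewrite -{1}[u](subrK v); apply: le_trans (enormD _ _) _.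
  by rewrite lerD2r.
apply: lerD; apply: le_trans (opnormZ_le _ _) _; rewrite normrM normr_nat.
  by rewrite mulrAC ler_wpM2r // ler_wpM2l.
set M := Num.min _ _.
have uvM : enorm u + enorm v <= M by rewrite le_min lexx andbT; lra.
rewrite -[leRHS]mulrA mulrAC -mulrA -[leRHS]mulrA ler_wpM2l //.
have -> : e * (`|f x0 ^+ (p - 2)| * M) = `|f x0 ^+ (p - 2)| * (e * M) by ring.
rewrite mulrC ler_wpM2l //; apply: le_trans (opnorm_outer_sub _ _) _.
by rewrite ler_pM ?addr_ge0 ?enorm_ge0.
Qed.

Lemma E_simplex_grad_ge0 (R : realType) (n k : nat) L (T : 'M[R]_(n, k)) :
  0 <= L -> 0 <= E_simplex_grad L T.
Proof.
by move=> L0; rewrite mulr_ge0 ?opnorm_ge0 // mulr_ge0 // divr_ge0 ?sqrtr_ge0.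
Qed.

(** Every sample point lies in the open ball, where [f] is continuous, except
    possibly the points [x0 + s^i + t^j]. *)
Lemma sample_set_reachable (R : realType) (n m k : nat) (f : 'cV[R]_n -> R) x0 r
    (S : 'M[R]_(n, m)) (T : 'M[R]_(n, k)) : 0 < r ->
  twice_differentiable_on (eball x0 r) f ->
  0 < col_radius S -> 0 < col_radius T -> col_radius S + col_radius T <= r ->
  (forall i j, f @ within (eball x0 r) (nbhs (x0 + col i S + col j T)) -->
    f (x0 + col i S + col j T)) ->
  forall x, sample_set x0 S T x ->
    enorm (x - x0) <= col_radius S + col_radius T /\
    f @ within (eball x0 r) (nbhs x) --> f x.
Proof.
move=> r0 [df _] S0 T0 STr fST.
have inner w : enorm w < col_radius S + col_radius T ->
    enorm (x0 + w - x0) <= col_radius S + col_radius T /\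
    f @ within (eball x0 r) (nbhs (x0 + w)) --> f (x0 + w).
  rewrite addrDKl => wST; split; first exact: ltW.
  apply/within_continuous/df; rewrite /eball /= addrDKl.
  exact: lt_le_trans wST STr.
move=> x [[[->|[i ->]]|[j ->]]|[i [j ->]]].
- by have := inner 0; rewrite addr0 enorm0; apply; exact: addr_gt0.
- by apply: inner; apply: le_lt_trans (enorm_col_le _ _) _; rewrite ltrDl.
- by apply: inner; apply: le_lt_trans (enorm_col_le _ _) _; rewrite ltrDr.
- split; last exact: fST.
  rewrite -[x0 + _ + _]addrA addrDKl; apply: le_trans (enormD _ _) _.
  by rewrite lerD ?enorm_col_le.
Qed.

(* L1 and L2 are arbitrary Lipschitz constants of the gradient and of the
   Hessian on the ball, in particular the least ones.

   The hypothesis on limits only concerns points x0 + s^i + t^j on the boundary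
   of the open ball B(x0; Delta): inside, it follows from f being C^3.  The
   inclusion of the balls puts these points in the closed ball only, and the
   estimate fails if f jumps at one of them: take n = m = k = 1, x0 = 0,
   S = T = 1, Delta = 2, p = 2 and f = 1 except f 2 = 2.

   The points y enumerate the sample set starting from x0; the bound is claimed
   for every such enumeration. *)
Theorem corollary5p4 (R : realType) (n m k : nat)
    (f : 'cV[R]_n -> R) (x0 : 'cV[R]_n) (Delta : R)
    (S : 'M[R]_(n, m)) (T : 'M[R]_(n, k)) (L1 L2 : R) (p : nat)
    (n_gt0 : (0 < n)%N)
    (Delta_gt0 : 0 < Delta)
    (f_C3 : continuously_differentiable 3 (eball x0 Delta) f)
    (L1_grad : lipschitz_grad (eball x0 Delta) f L1)
    (L2_hess : lipschitz_hess (eball x0 Delta) f L2)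
    (S_full : row_free S)
    (T_full : row_free T)
    (balls_sub : forall i : 'I_m,
      eball (x0 + col i S) (col_radius T) `<=` eball x0 Delta)
    (f_boundary : forall (i : 'I_m) (j : 'I_k),
      f @ within (eball x0 Delta) (nbhs (x0 + col i S + col j T)) -->
        f (x0 + col i S + col j T))
    (p_ge2 : (2 <= p)%N) :
  opnorm (simplex_calc_hess f p x0 S T - hess (fun x => f x ^+ p) x0) <=
    (p%:R * E_nested_hess L2 S T * `|f x0 ^+ (p - 1)| +
     (p * (p - 1))%:R * E_simplex_grad L1 T * `|f x0 ^+ (p - 2)| *
       M_simplex f L1 x0 S T) * Delta_u S T /\
  (poised (sample_set x0 S T) ->
   forall y : 'I_(quad_size n).+1 -> 'cV[R]_n,
     y ord0 = x0 -> injective y -> range y = sample_set x0 S T ->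
     opnorm (quad_calc_hess f p x0 S T - hess (fun x => f x ^+ p) x0) <=
       (p%:R * E_nested_hess L2 S T * `|f x0 ^+ (p - 1)| +
        (p * (p - 1))%:R * E_grad_quad L2 S T y * `|f x0 ^+ (p - 2)| *
          M_quad f L2 x0 S T y * Delta_u S T) * Delta_u S T).
Proof.
have [f_diff f_part] : twice_differentiable_on (eball x0 Delta) f.
  by case: f_C3 => df df'; split=> // j; case: (df' j).
have df := conj f_diff f_part.
have S0 := col_radius_gt0 n_gt0 S_full; have T0 := col_radius_gt0 n_gt0 T_full.
have STr : col_radius S + col_radius T <= Delta.
  have [i <-] := exists_col_radius S0.
  exact: eball_sub_radius n_gt0 T0 (balls_sub i).
have L1_ge0 : 0 <= L1.
  apply: (@lipschitz_constant_ge0 _ _ x0 Delta L1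
    (fun x y => enorm (grad f x - grad f y))) => // x y; exact: enorm_ge0.
have L2_ge0 : 0 <= L2.
  apply: (@lipschitz_constant_ge0 _ _ x0 Delta L2
    (fun x y => opnorm (hess f x - hess f y))) => // x y; exact: opnorm_ge0.
have N_err := nested_hess_error n_gt0 Delta_gt0 L2_ge0 df L2_hess S_full T_full STr
  f_boundary.
set u := Delta_u S T in N_err *.
have Tu : col_radius T <= u by rewrite le_max lexx orbT.
split=> [|pS y y0 _ yS].
  have T_lt : col_radius T < Delta by lra.
  have g_err : enorm (simplex_grad f x0 T - grad f x0) <= E_simplex_grad L1 T * u.
    apply: le_trans (simplex_grad_error n_gt0 Delta_gt0 L1_ge0 df L1_grad T_full T_lt) _.
    by rewrite ler_wpM2l ?E_simplex_grad_ge0.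
  apply: le_trans (power_hess_error Delta_gt0 p_ge2 df N_err g_err) _.
  rewrite /M_simplex -/u le_eqVlt; apply/orP; left; apply/eqP; ring.
have Sf := sample_set_reachable Delta_gt0 df S0 T0 STr f_boundary.
have g_err := grad_quad_error Delta_gt0 L2_ge0 (addr_gt0 S0 T0) STr df L2_hess Sf pS
  y0 yS.
apply: le_trans (power_hess_error Delta_gt0 p_ge2 df N_err g_err) _.
rewrite /M_quad -/u le_eqVlt; apply/orP; left; apply/eqP; ring.
Qed.
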